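(* Let $m,n,\ell$ be integers with $2\le m\le n\le \ell$ and $(m-1)(n-1)+1\le \ell\le mn$. Then every typical rank of real $m\times n\times \ell$ tensors lies in $\{\ell,\ell+1\}$, and $\ell$ is a typical rank.
   Context: A tensor $T=(t_{i,j,k})\in\mathbb R^{m\times n\times \ell}$ is called a Gaussian tensor if its entries are i.i.d. standard Gaussian. The rank of $T$ is the minimal $r$ such that $T=\sum_{i=1}^r a_i\otimes b_i\otimes c_i$ with $a_i\in\mathbb R^m,b_i\in\mathbb R^n,c_i\in\mathbb R^\ell$. An integer $r>0$ is a typical rank for the format $m\times n\times\ell$ if $\Pr\{\mathrm{rank}(T)=r\}>0$ for a Gaussian tensor $T\in\mathbb R^{m\times n\times\ell}$. *)

(* Defs.v *)
From HB Require Import structures.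
From mathcomp Require Import all_boot all_order all_algebra.
From mathcomp Require Import all_classical all_reals all_analysis.
Set Implicit Arguments. Unset Strict Implicit. Unset Printing Implicit Defensive.
Import Order.TTheory GRing.Theory Num.Theory.
Local Open Scope classical_set_scope.
Local Open Scope ring_scope.

Definition tensor (R : realType) (m n l : nat) := 'I_m -> 'I_n -> 'I_l -> R.

Definition rank_le (R : realType) (m n l : nat) (T : tensor R m n l) (r : nat) : Prop :=
  exists (a : 'I_r -> 'I_m -> R) (b : 'I_r -> 'I_n -> R) (c : 'I_r -> 'I_l -> R),
    forall i j k, T i j k = \sum_(p < r) a p i * b p j * c p k.

Definition tensor_rank_is (R : realType) (m n l : nat) (T : tensor R m n l) (r : nat) : Prop :=
  rank_le T r /\ (forall r', rank_le T r' -> (r <= r')%N).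

Fixpoint gauss_iint (R : realType) (k : nat) (f : (nat -> R) -> \bar R) (x : nat -> R)
  : \bar R :=
  match k with
  | 0%N => f x
  | k'.+1 => (\int[normal_prob (0:R) 1]_t
               gauss_iint k' f (fun i => if i == k' then t else x i))%E
  end.

Definition gauss_prob (R : realType) (N : nat) (S : set (nat -> R)) : \bar R :=
  gauss_iint N (fun x => (\1_S x)%:E) (fun _ => 0).

Definition tensor_of (R : realType) (m n l : nat) (x : nat -> R) : tensor R m n l :=
  fun i j k => x ((i * n + j) * l + k)%N.

Definition typical_rank (R : realType) (m n l r : nat) : Prop :=
  (0 < r)%N /\
  (0 < gauss_prob (m * n * l)%N
         [set x : nat -> R | @tensor_rank_is R m n l (@tensor_of R m n l x) r])%E.

(* Main.v *)
Require Import Defs.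
From HB Require Import structures.
From mathcomp Require Import all_boot all_order all_algebra.
From mathcomp Require Import all_classical all_reals all_analysis.
From mathcomp Require Import ring lra zify.
Set Implicit Arguments. Unset Strict Implicit. Unset Printing Implicit Defensive.
Import Order.TTheory GRing.Theory Num.Theory numFieldNormedType.Exports.
Local Open Scope classical_set_scope.
Local Open Scope ring_scope.

(* Write [m = M + 1], [n = N + 1], [K = M N].  A tensor has rank at most [r] iff
   the span [L] of its [l] slices, which are m x n matrices, lies in a space
   spanned by [r] rank-one matrices.

   Upper bound.  Let [p] be the matrix unit at (0, 0).  The rank-one matrices
   (1, u) (1, v)^T lying in [L + p] are the solutions z = (u, v) of quadratic
   systems z = t w + C (u (x) v), one for each slice of index at least [K].
   For small [t] such a system has a unique small solution z(t), whose Taylor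
   coefficients are polynomials in (C, w).  If the coefficients of
   t^2, ..., t^(K+1) in u(t) (x) v(t) form an invertible matrix, no nonzero
   functional on [L + p] vanishes on all these curves, so [L + p] is spanned by
   l + 1 rank-one matrices.  Invertibility is a polynomial condition, and it holds for the
   monomial curve u_i = t^(i+1), v_j = t^(1 + M j), for which
   u_i v_j = t^(i + M j + 2) and the matrix is the identity.

   Rank l.  A hyperplane of [L + p] not containing [p] cuts the monomial curve in
   the zeros of a polynomial of degree K + 1; if these are real and simple,
   they persist under perturbation by the intermediate value theorem, and they
   keep spanning the hyperplane.  This gives a box of tensors of rank at most l,
   while a nonvanishing l x l minor forces rank at least l. *)

(** * Lower bounds and null sets for the iterated Gaussian integral *)

(** The integral of a nonnegative function is a supremum over the simple functions below it, so it
    grows with the function even when measurability is unknown, as for indicators of rank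
    conditions. *)
Lemma ge0_le_lower_integral d (T : measurableType d) (R : realType)
    (mu : {measure set T -> \bar R}) (f g : T -> \bar R) :
  (forall t, 0 <= f t)%E -> (forall t, f t <= g t)%E ->
  (\int[mu]_t f t <= \int[mu]_t g t)%E.
Proof.
move=> f0 fg; have g0 t : (0 <= g t)%E by exact: le_trans (f0 t) (fg t).
rewrite !ge0_integralTE//; apply: le_ereal_sup => _ [h /= hf <-].
by exists h => //= t; exact: le_trans (hf t) (fg t).
Qed.

Lemma measure_setDn d (T : measurableType d) (R : realType)
    (mu : {measure set T -> \bar R}) (A B : set T) :
  measurable A -> measurable B -> mu B = 0%E -> mu (A `\` B) = mu A.
Proof.
move=> mA mB B0; have mAB : measurable (A `\` B) by exact: measurableD.
apply/eqP; rewrite eq_le le_measure ?inE//=.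
rewrite -[leRHS]adde0 -B0 (le_trans _ (measureU2 _ mAB mB))// le_measure ?inE//.
  exact: measurableU.
by move=> t At; have [Bt|Bt] := pselect (B t); [right|left].
Qed.

Section gaussian_line.
Variable R : realType.
Local Notation gauss := (normal_prob (0 : R) 1).

Lemma gauss_finite0 (s : seq R) : gauss [set` s] = 0%E.
Proof.
have cs : countable [set` s] by apply: finite_set_countable; exact: finite_seq.
have ms : measurable [set` s] by apply: countable_measurable.
have /null_content_dominatesP dom := @normal_prob_dominates R 0 1.
by apply: dom => //; exact: countable_lebesgue_measure0.
Qed.

Lemma gauss_ball_gt0 (a e : R) : 0 < e -> (0 < gauss [set` `[(a - e)%R, (a + e)%R]%R])%E.
Proof.
move=> e0; set D := [set` `[(a - e)%R, (a + e)%R]%R] : set R.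
(* [|a| + e] bounds the absolute value on the interval, so [c] bounds the density from below
   there. *)
pose c := @normal_peak R 1 * expR (- (`|a| + e) ^+ 2 / (1 ^+ 2 *+ 2)).
have c0 : 0 < c by rewrite mulr_gt0 ?expR_gt0// normal_peak_gt0// oner_neq0.
apply: (@lt_le_trans _ _ (\int[lebesgue_measure]_(x in D) (cst c%:E) x)%E).
  have mD : lebesgue_measure D = (a + e - (a - e))%:E.
    rewrite /D lebesgue_measure_itv /= lte_fin.
    by have -> : a - e < a + e by lra.
  rewrite integral_cst//=; last exact: measurable_itv.
  by rewrite mD -EFinM lte_fin mulr_gt0//; lra.
rewrite /normal_prob; apply: ge0_le_integral => //=.
- exact: measurable_itv.
- by move=> x _; rewrite lee_fin ltW.
- apply/measurable_realfun.measurable_EFinP; apply: measurable_funTS; exact: measurable_normal_pdf.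
- move=> x; rewrite /D/= in_itv/= => /andP[ax xa].
  rewrite lee_fin normal_pdfE ?oner_neq0// /c ler_pM2l ?normal_peak_gt0 ?oner_neq0//.
  rewrite ler_expR ler_pM2r ?invr_gt0 ?expr1n// subr0 lerN2.
  rewrite -(ger0_norm (sqr_ge0 x)) normrX lerXn2r ?nnegrE ?addr_ge0 ?(ltW e0)//.
  by rewrite ler_norml opprD; have := ler_norm a; have := ler_norm (- a); rewrite normrN; lra.
Qed.

Lemma gauss_int_cofinite0 (f : R -> \bar R) (s : seq R) :
  (forall t, 0 <= f t)%E -> (forall t, t \notin s -> f t = 0%E) ->
  (\int[gauss]_t f t = 0)%E.
Proof.
move=> f0 fs; apply/eqP; rewrite eq_le integral_ge0// andbT.
have ms : measurable [set` s].
  by apply: countable_measurable => //; apply: finite_set_countable; exact: finite_seq.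
(* The function is dominated by [+oo] on the null set [s] and by [0] elsewhere. *)
apply: (@le_trans _ _ (\int[gauss]_(t in [set` s]) (cst +oo%E t))%E).
  rewrite [leRHS]integral_mkcond; apply: ge0_le_lower_integral => // t.
  rewrite /patch; case: ifPn => [_|]; first by rewrite leey.
  by rewrite notin_setE/= => /negP/fs ->.
rewrite (@null_set_integral _ _ R gauss _ _ ms)//.
exact: gauss_finite0.
Qed.

Lemma gauss_int_cofinite_lb (f : R -> \bar R) (s : seq R) (D : set R) (c : R) :
  measurable D -> 0 <= c ->
  (forall t, 0 <= f t)%E -> (forall t, D t -> t \notin s -> c%:E <= f t)%E ->
  (c%:E * gauss D <= \int[gauss]_t f t)%E.
Proof.
move=> mD c0 f0 fs.
have ms : measurable [set` s].
  by apply: countable_measurable => //; apply: finite_set_countable; exact: finite_seq.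
have -> : gauss D = gauss (D `\` [set` s]).
  rewrite (@measure_setDn _ _ R gauss _ _ mD ms)//; exact: gauss_finite0.
rewrite -integral_cst; last exact: measurableD.
rewrite integral_mkcond; apply: ge0_le_lower_integral => t.
  by rewrite /patch; case: ifP => //=; rewrite lee_fin.
by rewrite /patch; case: ifPn => // /[!inE]-[Dt /negP st]; exact: fs.
Qed.

End gaussian_line.

(** Polynomial functions of a sequence of coordinates, as an inductive closure: restriction to lines
    and continuity go by induction, and determinants are covered without writing polynomials
    down. *)
Inductive polyfun (R : realType) : ((nat -> R) -> R) -> Prop :=
| polyfun_cst c : polyfun (fun=> c)
| polyfun_coord i : polyfun (fun x => x i)
| polyfunD f g : polyfun f -> polyfun g -> polyfun (fun x => f x + g x)
| polyfunM f g : polyfun f -> polyfun g -> polyfun (fun x => f x * g x).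

Section polyfun_theory.
Variable R : realType.
Implicit Types (f g : (nat -> R) -> R) (x y a : nat -> R).

Lemma polyfun_ext f g : f =1 g -> polyfun f -> polyfun g.
Proof. by move=> /funext ->. Qed.

Lemma polyfunN f : polyfun f -> polyfun (fun x => - f x).
Proof.
move=> pf; apply: (@polyfun_ext (fun x => -1 * f x)) => [x|]; first by rewrite mulN1r.
by apply: polyfunM => //; exact: polyfun_cst.
Qed.

Lemma polyfun_sum (I : Type) (r : seq I) (P : pred I) (F : I -> (nat -> R) -> R) :
  (forall i, P i -> polyfun (F i)) -> polyfun (fun x => \sum_(i <- r | P i) F i x).
Proof.
move=> pF; elim: r => [|i r IH].
  by apply: polyfun_ext (polyfun_cst _) => x; rewrite big_nil.
have [Pi|Pi] := boolP (P i).
  by apply: polyfun_ext (polyfunD (pF _ Pi) IH) => x; rewrite big_cons Pi.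
by apply: polyfun_ext IH => x; rewrite big_cons (negbTE Pi).
Qed.

Lemma polyfun_prod (I : Type) (r : seq I) (P : pred I) (F : I -> (nat -> R) -> R) :
  (forall i, P i -> polyfun (F i)) -> polyfun (fun x => \prod_(i <- r | P i) F i x).
Proof.
move=> pF; elim: r => [|i r IH].
  by apply: polyfun_ext (polyfun_cst _) => x; rewrite big_nil.
have [Pi|Pi] := boolP (P i).
  by apply: polyfun_ext (polyfunM (pF _ Pi) IH) => x; rewrite big_cons Pi.
by apply: polyfun_ext IH => x; rewrite big_cons (negbTE Pi).
Qed.

Lemma polyfun_det p (A : (nat -> R) -> 'M[R]_p) :
  (forall i j, polyfun (fun x => A x i j)) -> polyfun (fun x => \det (A x)).
Proof.
move=> pA; apply: polyfun_sum => s _; apply: polyfunM; first exact: polyfun_cst.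
by apply: polyfun_prod => i _.
Qed.

Lemma polyfun_adj p (A : (nat -> R) -> 'M[R]_p) :
  (forall i j, polyfun (fun x => A x i j)) ->
  forall i j, polyfun (fun x => (\adj (A x)) i j).
Proof.
move=> pA i j; apply: (@polyfun_ext (fun x => (-1) ^+ (j + i) * \det (row' j (col' i (A x))))).
  by move=> x; rewrite mxE.
apply: polyfunM; first exact: polyfun_cst.
by apply: polyfun_det => i' j'; apply: polyfun_ext (pA (lift j i') (lift i j')) => x; rewrite !mxE.
Qed.

Lemma polyfun_line f y (k : nat) : polyfun f ->
  exists q : {poly R}, forall t, f (fun i : nat => if i == k then t else y i) = q.[t].
Proof.
elim=> [c|i|{}f g _ [p fp] _ [q gq]|{}f g _ [p fp] _ [q gq]].
- by exists c%:P => t; rewrite hornerC.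
- have [ik|ik] := boolP (i == k); [exists 'X|exists (y i)%:P] => t.
    by rewrite hornerX.
  by rewrite hornerC.
- by exists (p + q) => t; rewrite fp gq hornerD.
- by exists (p * q) => t; rewrite fp gq hornerM.
Qed.

Lemma polyfun_continuous f a (e : R) : polyfun f -> 0 < e ->
  exists2 d, 0 < d & forall x, (forall i, `|x i - a i| <= d) -> `|f x - f a| <= e.
Proof.
have minl (u v : R) : Num.min u v <= u by rewrite ge_min lexx.
have minr (u v : R) : Num.min u v <= v by rewrite ge_min lexx orbT.
move=> pf; elim: pf e => [c|i|{}f g _ fP _ gP|{}f g _ fP _ gP] e e0.
- by exists 1 => // x _; rewrite subrr normr0 ltW.
- by exists e.
- have [d1 d10 h1] := fP (e / 2) ltac:(lra).
  have [d2 d20 h2] := gP (e / 2) ltac:(lra).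
  exists (Num.min d1 d2) => [|x xa]; first by rewrite lt_min d10.
  have := h1 x (fun i => le_trans (xa i) (minl _ _)).
  have := h2 x (fun i => le_trans (xa i) (minr _ _)).
  by rewrite !ler_norml; lra.
- pose c := `|f a| + `|g a| + 1.
  have c1 : 1 <= c by rewrite lerDr addr_ge0.
  (* [u <= 1] makes the product of the two increments at most [u], and [u * c <= e / 3] then bounds
     each of the three terms of the expansion by [e / 3]. *)
  pose u := Num.min (e / (3 * c)) 1.
  have u0 : 0 < u by rewrite lt_min ltr01 divr_gt0//; lra.
  have [d1 d10 h1] := fP u u0.
  have [d2 d20 h2] := gP u u0.
  exists (Num.min d1 d2) => [|x xa]; first by rewrite lt_min d10.
  have fx := h1 x (fun i => le_trans (xa i) (minl _ _)).
  have gx := h2 x (fun i => le_trans (xa i) (minr _ _)).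
  have -> : f x * g x - f a * g a =
    (f x - f a) * (g x - g a) + f a * (g x - g a) + (f x - f a) * g a by ring.
  have u1 : u <= 1 by rewrite ge_min lexx orbT.
  have uc : u * c <= e / 3.
    rewrite (@le_trans _ _ (e / (3 * c) * c))// ?ler_wpM2r ?ge_min ?lexx//; first lra.
    by rewrite le_eqVlt; apply/orP; left; apply/eqP; field; lra.
  rewrite (le_trans (ler_normD _ _))// (le_trans (lerD (ler_normD _ _) (lexx _)))//.
  rewrite !normrM.
  have A1 : `|f x - f a| * `|g x - g a| <= u by rewrite -(mulr1 u) ler_pM// (le_trans gx).
  have A2 : `|f a| * `|g x - g a| <= u * c.
    by rewrite mulrC ler_pM// /c; have := normr_ge0 (g a); lra.
  have A3 : `|f x - f a| * `|g a| <= u * c.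
    by rewrite ler_pM// /c; have := normr_ge0 (f a); lra.
  have A4 : u <= u * c by rewrite ler_peMr// ltW.
  by lra.
Qed.

End polyfun_theory.

Section gaussian_measure_bounds.
Variable R : realType.
Implicit Types (f : (nat -> R) -> R) (S : set (nat -> R)) (x y a : nat -> R).

Lemma gauss_iint_indic_ge0 k S x : (0 <= gauss_iint k (fun x => (\1_S x)%:E) x)%E.
Proof.
elim: k x => [|k IH] x /=; first by rewrite lee_fin.
by apply: integral_ge0 => t _; exact: IH.
Qed.

Lemma polyfun_neq0_cofinite f y (k : nat) : polyfun f -> f y != 0 ->
  exists s : seq R, forall t, t \notin s -> f (fun i : nat => if i == k then t else y i) != 0.
Proof.
move=> pf fy; have [q fq] := polyfun_line y k pf.
have q0 : q != 0.
  (* The line passes through [y] at [t = y k], so a zero restriction would contradict [f y != 0]. *)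
  apply: contraNneq fy => q0; have := fq (y k); rewrite q0 horner0 => /eqP.
  congr (f _ == 0); apply/funext => i; by case: eqP => // ->.
have [s sq] : exists s : seq R, forall t, root q t -> t \in s.
  have [n qn] := ubnP (size q); elim: n => // n IH in q q0 qn {fq} *.
  have [[t rt]|nr] := pselect (exists t, root q t); last first.
    by exists [::] => t rt; case: nr; exists t.
  have /factor_theorem[p qp] := rt; have p0 : p != 0.
    by apply: contraNneq q0 => p0; rewrite qp p0 mul0r.
  have [|s sP] := IH p p0.
    by move: qn; rewrite qp size_mul ?polyXsubC_eq0// size_XsubC addn2.
  exists (t :: s) => u; rewrite qp rootM root_XsubC inE => /orP[/sP->|->//].
  by rewrite orbT.
by exists s => t ts; rewrite fq; apply: contra ts => /sq.
Qed.

(* The integrals below are lower integrals of possibly nonmeasurable functions;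
   monotonicity is all that these inductions use. *)
Lemma gauss_iint_zeros f S k x : polyfun f -> (forall z, S z -> f z = 0) ->
  (exists2 y, (forall i, (k <= i)%N -> y i = x i) & f y != 0) ->
  gauss_iint k (fun x => (\1_S x)%:E) x = 0%E.
Proof.
move=> pf Sf; elim: k x => [|k IH] x [y yx fy] /=.
  rewrite indicE memNset// => /Sf fx; move: fy.
  by rewrite (_ : y = x) ?fx ?eqxx//; apply/funext => i; exact: yx.
have [s sP] := polyfun_neq0_cofinite k pf fy.
apply: (gauss_int_cofinite0 (s := s)) => t; first exact: gauss_iint_indic_ge0.
move=> /sP ft; apply: IH; eexists; last exact: ft.
by move=> i ki /=; case: eqVneq => // ik; apply: yx; rewrite ltn_neqAle eq_sym ik.
Qed.

(** The point [y] shows that [f] does not vanish identically once the coordinates from [k] on are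
    fixed; each integration then loses only finitely many values of an interval of positive mass. *)
Lemma gauss_iint_box f S a (e : R) k x : polyfun f -> 0 < e ->
  (forall z, (forall i, `|z i - a i| <= e) -> f z != 0 -> S z) ->
  (forall i, (k <= i)%N -> `|x i - a i| <= e) ->
  (exists2 y, (forall i, (k <= i)%N -> y i = x i) & f y != 0) ->
  (0 < gauss_iint k (fun x => (\1_S x)%:E) x)%E.
Proof.
move=> pf e0 SP.
(* The bound [c] must not depend on [x]: pointwise positivity alone does not pass through the lower
   integral of a possibly nonmeasurable function. *)
suff H : exists2 c : R, 0 < c & forall x, (forall i, (k <= i)%N -> `|x i - a i| <= e) ->
    (exists2 y, (forall i, (k <= i)%N -> y i = x i) & f y != 0) ->
    (c%:E <= gauss_iint k (fun x => (\1_S x)%:E) x)%E.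
  have [c c0 H'] := H => xa xy; apply: lt_le_trans (H' _ xa xy).
  by rewrite lte_fin.
elim: k {x} => [|k [c c0 IH]] /=.
  exists 1 => // x xa [y yx fy]; rewrite indicE mem_set//.
  by apply: SP => [i|]; [exact: xa|rewrite (_ : x = y)//; apply/funext => i; rewrite yx].
pose D := [set` `[(a k - e)%R, (a k + e)%R]%R] : set R.
have mD : measurable D by exact: measurable_itv.
have D0 := gauss_ball_gt0 (a k) e0; rewrite -/D in D0.
have Dfin : normal_prob 0 1 D \is a fin_num.
  exact: (@fin_num_measure _ _ R (normal_prob 0 1)).
exists (c * fine (normal_prob 0 1 D)).
  by rewrite mulr_gt0// fine_gt0// D0 ltey_eq Dfin.
move=> x xa [y yx fy]; rewrite EFinM fineK//.
have [s sP] := polyfun_neq0_cofinite k pf fy.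
apply: (gauss_int_cofinite_lb (s := s)) => //; first exact: ltW.
  by move=> t; exact: gauss_iint_indic_ge0.
move=> t; rewrite /D/= in_itv/= => /andP[ta at_] /sP ft; apply: IH.
  move=> i ki; case: eqVneq => [->|ik]; first by rewrite ler_norml; lra.
  by apply: xa; rewrite ltn_neqAle eq_sym ik.
eexists; last exact: ft.
by move=> i ki /=; case: eqVneq => // ik; apply: yx; rewrite ltn_neqAle eq_sym ik.
Qed.

End gaussian_measure_bounds.

(** * Spanning by rank-one matrices *)

(** Greedy choice: while the chosen members do not span [V], some column of their cokernel kills
    them but not [V], so a further member lies outside their span and raises the rank. Once [V] is
    reached, zero rows pad the list. *)
Lemma span_by_members (F : fieldType) s D (V : 'M[F]_(s, D)) (S : 'rV[F]_D -> Prop) :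
  S 0 -> (forall v, S v -> (v <= V)%MS) ->
  (forall u : 'cV[F]_D, (forall v, S v -> v *m u = 0) -> V *m u = 0) ->
  exists2 W : 'M[F]_(s, D), (forall i, S (row i W)) & (V <= W)%MS.
Proof.
move=> S0 SV SdV.
suff /(_ s)[W [WS rW]] : forall r, exists W : 'M[F]_(r, D),
    (forall i, S (row i W)) /\ (minn r (\rank V) <= \rank W)%N.
  exists W => //; rewrite (minn_idPr (rank_leq_row V)) in rW.
  have WV : (W <= V)%MS by apply/row_subP => i; exact: SV.
  by rewrite -(mxrank_leqif_sup WV) eqn_leq rW mxrankS.
elim=> [|r [W [WS rW]]].
  by exists 0; split; [case|rewrite min0n].
have Srow (v : 'rV_D) : S v -> forall i : 'I_(1 + r), S (row i (col_mx v W)).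
  move=> Sv i; case: (splitP i) => j ij.
    have -> : i = lshift r j by apply/val_inj.
    by rewrite rowKu row_id.
  have -> : i = rshift 1 j by apply/val_inj.
  by rewrite rowKd.
have [VW|VW] := boolP (V <= W)%MS.
  exists (col_mx (0 : 'rV_D) W); split; first exact: Srow.
  have WW : (W <= col_mx (0 : 'rV_D) W)%MS by rewrite -addsmxE addsmxSr.
  by rewrite geq_min (leq_trans (mxrankS VW) (mxrankS WW)) orbT.
have [v [Sv vW]] : exists v, S v /\ ~~ (v <= W)%MS.
  apply/not_existsP => nS; move/negP: VW; apply.
  rewrite submxE; apply/eqP/matrixP => i j; rewrite [RHS]mxE.
  have E : col j (V *m cokermx W) = 0.
    rewrite colE -mulmxA -colE; apply: SdV => v Sv; rewrite colE mulmxA.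
    have : (v <= W)%MS by apply/negPn/negP => vW; apply: (nS v).
    by rewrite submxE => /eqP ->; rewrite mul0mx.
  by move/colP/(_ i): E; rewrite mxE => ->; rewrite mxE.
exists (col_mx v W); split; first exact: Srow.
have : (W < col_mx v W)%MS.
  by rewrite ltmxE -!addsmxE addsmxSr addsmx_sub negb_and vW.
move=> /rank_ltmx rWv.
by rewrite (leq_trans _ rWv)//; lia.
Qed.

Section rank_by_duality.
Variables (R : realType) (m n l : nat).

Definition pairing (u B : 'I_m -> 'I_n -> R) := \sum_i \sum_j u i j * B i j.

Lemma pairing_mxvec (u B : 'I_m -> 'I_n -> R) (v : 'cV[R]_(m * n)) :
  (forall i j, u i j = v (mxvec_index i j) 0) ->
  (mxvec (\matrix_(i, j) B i j) *m v) 0 0 = pairing u B.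
Proof.
move=> uv; rewrite mxE (reindex _ (curry_mxvec_bij _ _))/= /pairing pair_bigA/=.
by apply: eq_bigr => -[i j] _ /=; rewrite mxvecE mxE uv mulrC.
Qed.

(** If no functional separates the span of the [B r] from its rank-one matrices, [s] of these span
    it and hence express every slice. The [B r] may include more than slices, which makes room for
    the extra matrix unit. *)
Lemma rank_le_dual s (T : tensor R m n l) (B : 'I_s -> 'I_m -> 'I_n -> R) :
  (forall k, exists r, forall i j, T i j k = B r i j) ->
  (forall u, (forall a b c, (forall i j, a i * b j = \sum_r c r * B r i j) ->
                pairing u (fun i j => a i * b j) = 0) ->
             forall r, pairing u (B r) = 0) ->
  rank_le T s.
Proof.
move=> TB Bu; pose V := \matrix_(r < s) mxvec (\matrix_(i, j) B r i j).
pose S (v : 'rV_(m * n)) := (v <= V)%MS /\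
  exists a b, v = mxvec (\matrix_(i, j) (a i * b j)).
have [||u uS|W WS VW] := @span_by_members _ _ _ V S.
- split; first exact: sub0mx.
  exists (fun=> 0), (fun=> 0); apply/rowP => k.
  by case/mxvec_indexP: k => i j; rewrite mxvecE !mxE mul0r.
- by move=> v [].
- pose u' i j := u (mxvec_index i j) 0.
  have {}Bu r : pairing u' (B r) = 0.
    apply: Bu => a b c abc.
    rewrite -(@pairing_mxvec u' _ u)// uS ?mxE//; split; last by exists a, b.
    apply/submxP; exists (\row_r c r); apply/rowP => k.
    case/mxvec_indexP: k => i j; rewrite mxvecE !mxE abc.
    by apply: eq_bigr => r' _; rewrite !mxE mxvecE mxE.
  apply/matrixP => r j; rewrite ord1 [RHS]mxE -[RHS](Bu r) -(@pairing_mxvec u' _ u)//.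
  by rewrite !mxE; apply: eq_bigr => k _; rewrite mxE.
- have [a aP] := choice (fun r => (WS r).2).
  have [b bP] := choice aP.
  have /submxP[C VC] := VW.
  have [p pP] := choice TB.
  exists a, b, (fun r k => C (p k) r) => i j k.
  rewrite pP; have /matrixP/(_ (p k) (mxvec_index i j)) := VC.
  rewrite mxE mxvecE mxE => ->; rewrite mxE; apply: eq_bigr => r _.
  have /rowP/(_ (mxvec_index i j)) := bP r; rewrite mxvecE !mxE => ->.
  by rewrite mulrC.
Qed.

(** A decomposition with [r] terms factors the square matrix of the minor through dimension [r]. *)
Lemma rank_le_minor (T : tensor R m n l) r (f : 'I_l -> 'I_m) (g : 'I_l -> 'I_n) :
  \det (\matrix_(k', k) T (f k') (g k') k) != 0 -> rank_le T r -> (l <= r)%N.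
Proof.
move=> d0 [a [b [c abc]]].
have E : \matrix_(k', k) T (f k') (g k') k =
    (\matrix_(k' < l, p < r) (a p (f k') * b p (g k'))) *m (\matrix_(p, k) c p k).
  by apply/matrixP => i j; rewrite !mxE abc; apply: eq_bigr => p _; rewrite !mxE.
have : \rank (\matrix_(k', k) T (f k') (g k') k) = l.
  by apply: mxrank_unit; rewrite unitmxE unitfE.
by move=> <-; rewrite E (leq_trans (mxrankM_maxl _ _))// rank_leq_col.
Qed.

End rank_by_duality.

(** * Quadratic systems *)

Lemma geometric_cauchy_lim (R : realType) (y : nat -> R) (B : R) :
  (forall i, `|y i.+1 - y i| <= B * 2^-1 ^+ i) ->
  exists L, forall i, `|L - y i| <= 2 * B * 2^-1 ^+ i.
Proof.
move=> yB; have B0 : 0 <= B by have := yB 0%N; rewrite expr0 mulr1; apply: le_trans.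
have cy : cvgn y.
  rewrite (_ : y = fun n => y 0%N + series (telescope y) n); last first.
    by apply/funext => n; exact: eq_sum_telescope.
  apply: is_cvgD; first exact: is_cvg_cst.
  apply: normed_cvg; apply: (@series_le_cvg _ _ (geometric B 2^-1)).
  - by move=> n /=; exact: normr_ge0.
  - by move=> n /=; rewrite mulr_ge0// exprn_ge0// invr_ge0.
  - exact: yB.
  - by apply: is_cvg_geometric_series; rewrite ger0_norm; lra.
(* The factor [1 - 2^-1 ^+ k], coming from a partial geometric sum, is what lets the induction
   close. *)
have yk i k : `|y (i + k)%N - y i| <= 2 * B * 2^-1 ^+ i * (1 - 2^-1 ^+ k).
  elim: k => [|k IH]; first by rewrite addn0 subrr normr0 expr0 subrr mulr0.
  rewrite addnS -(subrKA (y (i + k)%N)) (le_trans (ler_normD _ _))//.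
  have := yB (i + k)%N; rewrite exprD exprS.
  move: IH; set u := 2^-1 ^+ i; set v := 2^-1 ^+ k => h1 h2.
  by apply: le_trans (lerD h2 h1) _; rewrite le_eqVlt; apply/orP; left; apply/eqP; field.
exists (limn y) => i.
have yi n : (i <= n)%N -> `|y n - y i| <= 2 * B * 2^-1 ^+ i.
  move=> /subnKC <-; apply: le_trans (yk _ _) _.
  by rewrite ler_piMr ?gerBl ?mulr_ge0 ?exprn_ge0 ?invr_ge0.
rewrite ler_distl; apply/andP; split.
  apply: limr_ge => //; near=> n; have := yi n; rewrite ler_distl => /(_ _)/andP[]//.
  by near: n; exists i.
apply: limr_le => //; near=> n; have := yi n; rewrite ler_distl => /(_ _)/andP[]//.
by near: n; exists i.
Unshelve. all: by end_near.
Qed.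

Lemma geometric_le0 (R : realType) (x B : R) :
  (forall i, `|x| <= B * 2^-1 ^+ i) -> x = 0.
Proof.
move=> xB; apply/eqP; rewrite -normr_eq0 eq_le normr_ge0 andbT.
have c0 : (fun i : nat => B * 2^-1 ^+ i : R) @ \oo --> B * 0.
  by apply: cvgMr; apply: cvg_expr; rewrite ger0_norm; lra.
rewrite mulr0 in c0; rewrite -(cvg_lim _ c0)//.
by apply: limr_ge; [apply/cvg_ex; exists 0|near=> n; exact: xB].
Unshelve. all: by end_near.
Qed.

(** Stated over any ring because it is used both with real [t] and with [t] the indeterminate. The
    index [q] stands for the product of the coordinates [al q] and [be q]. *)
Definition quad_map (S : comNzRingType) (p K : nat) (al be : 'I_K -> 'I_p)
    (C : 'I_p -> 'I_K -> S) (w : 'I_p -> S) (t : S) (z : 'I_p -> S) (a : 'I_p) : S :=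
  t * w a + \sum_q C a q * (z (al q) * z (be q)).

(** Picard iteration from [0] with formal [t]: the coefficients of the iterates are polynomials in
    [C] and [w]. *)
Definition quad_iter (R : comNzRingType) (p K : nat) (al be : 'I_K -> 'I_p)
    (C : 'I_p -> 'I_K -> R) (w : 'I_p -> R) (i : nat) : 'I_p -> {poly R} :=
  iter i (quad_map al be (fun a q => (C a q)%:P) (fun a => (w a)%:P) 'X) (fun=> 0).

Section quadratic_system.
Variables (R : realType) (p K : nat) (al be : 'I_K -> 'I_p).
Implicit Types (C : 'I_p -> 'I_K -> R) (w z : 'I_p -> R) (t : R).

Lemma ler_norm_mulB (x y x' y' r D : R) :
  `|x| <= r -> `|y'| <= r -> `|x - x'| <= D -> `|y - y'| <= D ->
  `|x * y - x' * y'| <= 2 * r * D.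
Proof.
move=> xr yr xx yy.
have -> : x * y - x' * y' = x * (y - y') + (x - x') * y' by ring.
rewrite (le_trans (ler_normD _ _))// !normrM.
have H1 : `|x| * `|y - y'| <= r * D by rewrite ler_pM.
have H2 : `|x - x'| * `|y'| <= D * r by rewrite ler_pM.
by lra.
Qed.

Lemma ler_norm_wsum (c h : 'I_K -> R) (A D : R) : 0 <= D ->
  \sum_q `|c q| <= A -> (forall q, `|h q| <= D) -> `|\sum_q c q * h q| <= A * D.
Proof.
move=> D0 cA hD; rewrite (le_trans (ler_norm_sum _ _ _))//.
rewrite (@le_trans _ _ (\sum_q `|c q| * D))//; last first.
  by rewrite -mulr_suml ler_wpM2r.
by apply: ler_sum => q _; rewrite normrM ler_wpM2l.
Qed.

Lemma quad_map_lip C w t z z' (A r D : R) a :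
  \sum_q `|C a q| <= A -> (forall b, `|z b| <= r) -> (forall b, `|z' b| <= r) ->
  (forall b, `|z b - z' b| <= D) ->
  `|quad_map al be C w t z a - quad_map al be C w t z' a| <= A * (2 * r * D).
Proof.
move=> CA zr zr' zD.
have r0 : 0 <= r by exact: le_trans (zr a).
have D0 : 0 <= D by exact: le_trans (zD a).
rewrite /quad_map opprD addrACA subrr add0r -sumrB.
under eq_bigr do rewrite -mulrBr.
by apply: ler_norm_wsum => //; [rewrite !mulr_ge0|move=> q; exact: ler_norm_mulB].
Qed.

Lemma horner_quad_iter C w t i a :
  (quad_iter al be C w i.+1 a).[t] =
  quad_map al be C w t (fun b => (quad_iter al be C w i b).[t]) a.
Proof.
rewrite /quad_iter /= -/(quad_iter al be C w i) /quad_map !hornerE horner_sum.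
by congr (_ + _); apply: eq_bigr => q _; rewrite !hornerE.
Qed.

Section solution.
Variables (C : 'I_p -> 'I_K -> R) (w : 'I_p -> R) (A : R).
Hypotheses (A0 : 0 < A) (wA : forall a, `|w a| <= A)
  (CA : forall a, \sum_q `|C a q| <= A).

(** The ball of radius [2 * A * |t|] is stable: the linear part contributes at most [A * |t|], the
    quadratic part at most [4 * A ^+ 3 * |t| ^+ 2], which is below [A * |t|] for such [t]. *)
Lemma quad_iter_bound t i a : 8 * A ^+ 2 * `|t| <= 1 ->
  `|(quad_iter al be C w i a).[t]| <= 2 * A * `|t|.
Proof.
move=> t1; elim: i a => [|i IH] a.
  by rewrite horner0 normr0 !mulr_ge0// ltW.
rewrite horner_quad_iter /quad_map (le_trans (ler_normD _ _))//.
have H1 : `|t * w a| <= `|t| * A by rewrite normrM ler_wpM2l.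
have B0 : 0 <= 2 * A * `|t| by rewrite !mulr_ge0// ltW.
have H2 : `|\sum_q C a q * ((quad_iter al be C w i (al q)).[t] *
    (quad_iter al be C w i (be q)).[t])| <= A * ((2 * A * `|t|) * (2 * A * `|t|)).
  apply: ler_norm_wsum => //; first by rewrite mulr_ge0.
  by move=> q; rewrite normrM ler_pM.
have H3 : A * (2 * A * `|t| * (2 * A * `|t|)) <= A * `|t|.
  have -> : A * (2 * A * `|t| * (2 * A * `|t|)) = (A * `|t|) * (4 * A ^+ 2 * `|t|) by ring.
  by rewrite ler_piMr ?mulr_ge0// ?(ltW A0)//; lra.
by lra.
Qed.

(* Each iteration gains one power of [t], so the [i]-th iterate is the Taylor
   polynomial of the solution up to order [i]. *)
Lemma quad_iter_approx t z i a : 8 * A ^+ 2 * `|t| <= 1 ->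
  (forall b, `|z b| <= 2 * A * `|t|) -> (forall b, z b = quad_map al be C w t z b) ->
  `|z a - (quad_iter al be C w i a).[t]| <= 2 * A * (4 * A ^+ 2) ^+ i * `|t| ^+ i.+1.
Proof.
move=> t1 zt zE; elim: i a => [|i IH] a.
  by rewrite horner0 subr0 expr0 mulr1 expr1.
rewrite zE horner_quad_iter.
have := quad_map_lip w t (CA a) zt (fun b => quad_iter_bound i b t1) IH.
move=> /le_trans; apply; rewrite le_eqVlt; apply/orP; left; apply/eqP.
by rewrite !exprS; ring.
Qed.

(** On the stable ball the map contracts with factor [4 * A ^+ 2 * |t|], at most one half, so the
    iterates converge geometrically; the bound and the equation pass to the limit. *)
Lemma quad_solution_exists t : 8 * A ^+ 2 * `|t| <= 1 -> exists z,
  (forall b, `|z b| <= 2 * A * `|t|) /\ (forall b, z b = quad_map al be C w t z b).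
Proof.
move=> t1; set y := fun i b => (quad_iter al be C w i b).[t].
have half : A * (2 * (2 * A * `|t|)) <= 2^-1 by lra.
have yS i b : `|y i.+1 b - y i b| <= 2 * A * `|t| * 2^-1 ^+ i.
  elim: i b => [|i IH] b.
    by rewrite /y horner0 subr0 expr0 mulr1 quad_iter_bound.
  rewrite /y !(horner_quad_iter C w t) -!/(y _ _).
  have := quad_map_lip w t (CA b) (fun b => quad_iter_bound i.+1 b t1)
    (fun b => quad_iter_bound i b t1) IH.
  move=> /le_trans; apply; rewrite exprS.
  have D0 : 0 <= 2 * A * `|t| * 2^-1 ^+ i.
    by rewrite mulr_ge0 ?exprn_ge0 ?invr_ge0 ?mulr_ge0// ltW.
  have := ler_wpM2r D0 half; lra.
have [z zP] := choice (fun b => geometric_cauchy_lim (fun i => yS i b)).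
have zb b : `|z b| <= 2 * A * `|t|.
  apply/ler_addgt0Pr => e e0.
  have [i ie] : exists i, 2 * (2 * A * `|t|) * 2^-1 ^+ i < e.
    apply/not_existsP => H.
    have := @geometric_le0 R e (2 * (2 * A * `|t|)); rewrite gtr0_norm// => e00.
    have := e0; rewrite e00 ?ltxx// => i; rewrite leNgt; apply/negP; exact: H.
  have := zP b i; have := quad_iter_bound i b t1; rewrite -/(y i b) !ler_norml; lra.
exists z; split=> // b; apply/eqP; rewrite -subr_eq0; apply/eqP.
apply: (@geometric_le0 _ _ (2 * (2 * (2 * A * `|t|)))) => i.
have h1 := zP b i.+1.
have := quad_map_lip w t (CA b) zb (fun b => quad_iter_bound i b t1) (zP ^~ i).
rewrite -horner_quad_iter -/(y i.+1 b) => h2.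
have D0 : 0 <= 2 * (2 * A * `|t|) * 2^-1 ^+ i.
  by rewrite mulr_ge0 ?exprn_ge0 ?invr_ge0 ?mulr_ge0// ltW.
have := ler_wpM2r D0 half; rewrite exprS in h1.
move: h1 h2; rewrite !ler_norml; set u := 2^-1 ^+ i; lra.
Qed.

End solution.

(** At the coordinate where the two solutions differ most, contraction accounts for at most half of
    the difference and the change of system, measured at [z0] only, for at most [E]. *)
Lemma quad_solution_stable C w C0 w0 t t0 z z0 (A r E : R) :
  0 < A -> (forall a, \sum_q `|C a q| <= A) -> 4 * A * r <= 1 ->
  (forall b, `|z b| <= r) -> (forall b, z b = quad_map al be C w t z b) ->
  (forall b, `|z0 b| <= r) -> (forall b, z0 b = quad_map al be C0 w0 t0 z0 b) ->
  (forall a, `|quad_map al be C w t z0 a - quad_map al be C0 w0 t0 z0 a| <= E) ->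
  forall a, `|z a - z0 a| <= 2 * E.
Proof.
move=> A0 CA Ar zr zE zr0 zE0 hE a1.
pose a := [arg max_(b > a1) `|z b - z0 b|]%O.
have aM b : `|z b - z0 b| <= `|z a - z0 a|.
  by rewrite /a; case: arg_maxP => // i _; apply.
apply: le_trans (aM a1) _.
have := quad_map_lip w t (CA a) zr zr0 aM.
rewrite -zE; have := hE a; rewrite -zE0 => h1 h2.
have h3 : A * (2 * r * `|z a - z0 a|) <= 2^-1 * `|z a - z0 a|.
  by rewrite !mulrA ler_wpM2r//; lra.
suff : `|z a - z0 a| <= E + 2^-1 * `|z a - z0 a| by lra.
rewrite -[in leLHS](subrKA (quad_map al be C w t z0 a)).
by rewrite (le_trans (ler_normD _ _))// addrC lerD// (le_trans h2).
Qed.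

End quadratic_system.

(** Letting [t] tend to [0] from the right kills the constant term; division by [t] then lowers the
    order by one. *)
Lemma poly_low_coefs0 (R : realType) n (q : {poly R}) (e B : R) : 0 < e ->
  (forall t, 0 < t -> t <= e -> `|q.[t]| <= B * t ^+ n) ->
  forall i, (i < n)%N -> q`_i = 0.
Proof.
elim: n q e => // n IH q; elim/poly_ind: q => [|q c _] e e0 qB i ni.
  by rewrite coef0.
have [M qM] : exists M, forall t, 0 < t -> t <= 1 -> `|q.[t]| <= M.
  exists (\sum_(i < size q) `|q`_i|) => t t0 t1.
  rewrite horner_coef (le_trans (ler_norm_sum _ _ _))//; apply: ler_sum => j _.
  by rewrite normrM ler_piMr// normrX exprn_ile1// gtr0_norm.
have B0 : 0 <= B.
  have := qB e e0 (lexx _) => /(le_trans (normr_ge0 _)).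
  by rewrite pmulr_lge0// exprn_gt0.
have M0 : 0 <= M by apply: le_trans (qM 1 ltr01 (lexx _)).
have c0 : c = 0.
  apply/eqP; rewrite -normr_eq0 eq_le normr_ge0 andbT; apply/ler_addgt0Pr => d d0.
  pose t := Num.min (Num.min e 1) (d / (B + M + 1)).
  have t0 : 0 < t by rewrite !lt_min e0 ltr01 divr_gt0//; lra.
  have te : t <= e by rewrite /t !ge_min lexx.
  have t1 : t <= 1 by rewrite /t !ge_min lexx orbT.
  have td : t * (B + M + 1) <= d by rewrite -ler_pdivlMr ?ge_min ?lexx ?orbT//; lra.
  have := qB t t0 te; rewrite !hornerE.
  have tn : B * t ^+ n.+1 <= B * t.
    by rewrite ler_wpM2l// exprS ler_piMr ?(ltW t0)// exprn_ile1// ltW.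
  have qt : `|q.[t] * t| <= M * t.
    by rewrite normrM (gtr0_norm t0) ler_wpM2r ?qM// ltW.
  have : t * (B + M + 1) = B * t + M * t + t by ring.
  by move: qt tn; rewrite !ler_norml; lra.
rewrite c0 addr0 coefMX; case: i ni => //= i ni.
apply: (IH q e) => // t t0 te; have := qB t t0 te.
rewrite c0 addr0 hornerM hornerX normrM (gtr0_norm t0) exprSr mulrA.
by rewrite ler_pM2r.
Qed.

(** The [K]-th iterates are correct up to order [K] and divisible by [t], so their products are
    correct up to order [K.+1] and start at order 2: these are the orders kept as columns. *)
Definition jet_mx (R : comNzRingType) (p K : nat) (al be : 'I_K -> 'I_p)
    (C : 'I_p -> 'I_K -> R) (w : 'I_p -> R) : 'M[R]_K :=
  \matrix_(q, e) (quad_iter al be C w K (al q) * quad_iter al be C w K (be q))`_e.+2.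

(** A coordinate of exponent 1 satisfies [z a = t]; one of exponent [q.+2] is the product of the
    coordinates [al q] and [be q], whose exponents add up to it. *)
Lemma monomial_solution (S : comNzRingType) (p K : nat) (al be : 'I_K -> 'I_p)
    (ex : 'I_p -> nat) :
  (forall a, 0 < ex a <= K.+1)%N -> (forall q, ex (al q) + ex (be q) = q.+2)%N ->
  forall (t : S) a, t ^+ ex a = quad_map al be
    (fun a q => (ex a == q.+2)%:R) (fun a => (ex a == 1%N)%:R) t (fun b => t ^+ ex b) a.
Proof.
move=> ex_bound ex_sum t a.
rewrite /quad_map; under eq_bigr => q _ do rewrite -exprD ex_sum.
have /andP[e0 eK] := ex_bound a; have [e1|e1] := eqVneq (ex a) 1%N.
  by rewrite e1 mulr1 big1 ?addr0// => q _; rewrite mul0r.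
have qK : ((ex a).-2 < K)%N by lia.
rewrite mulr0 add0r (bigD1 (Ordinal qK))//= big1 ?addr0 => [|q qq].
  by rewrite (_ : (ex a).-2.+2 = ex a) ?eqxx ?mul1r//; lia.
rewrite (_ : _ == _ = false) ?mul0r//; apply/negbTE; apply: contraNneq qq => eq.
by apply/eqP/val_inj => /=; rewrite eq.
Qed.

Section jets.
Variables (R : realType) (p K : nat) (al be : 'I_K -> 'I_p).
Implicit Types (C : 'I_p -> 'I_K -> R) (w z : 'I_p -> R) (t : R).

Lemma quad_iter_dvdX C w i a : exists r, quad_iter al be C w i a = r * 'X.
Proof.
elim: i a => [|i IH] a; first by exists 0; rewrite mul0r.
have [r rP] := choice IH.
exists ((w a)%:P + \sum_q (C a q)%:P * (r (al q) * r (be q) * 'X)).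
rewrite /quad_iter /= -/(quad_iter al be C w i) /quad_map mulrDl mulrC; congr (_ + _).
by rewrite mulr_suml; apply: eq_bigr => q _; rewrite !rP; ring.
Qed.

(** Replacing the small solution by the [K]-th iterate in the relation gives a polynomial [Q] that
    is [O(t ^+ K.+2)]. Its coefficients of order 2 to [K.+1] form the row [l] times the jet
    matrix. *)
Lemma quad_curve_nondegenerate C w (l0 l1 : R) (l : 'I_K -> R) :
  \det (jet_mx al be C w) != 0 ->
  (forall t z, (forall a, z a = quad_map al be C w t z a) ->
    l0 + l1 * t + \sum_q l q * (z (al q) * z (be q)) = 0) ->
  [/\ l0 = 0, l1 = 0 & forall q, l q = 0].
Proof.
move=> dH lP.
pose A := 1 + \sum_a `|w a| + \sum_a \sum_q `|C a q|.
have S1 : 0 <= \sum_a `|w a| by apply: sumr_ge0.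
have S2 : 0 <= \sum_a \sum_q `|C a q| by do 2 apply: sumr_ge0 => ? _.
have A0 : 0 < A by rewrite /A; lra.
have wA a : `|w a| <= A.
  rewrite /A (bigD1 a)//=; have : 0 <= \sum_(i | i != a) `|w i| by apply: sumr_ge0.
  lra.
have CA a : \sum_q `|C a q| <= A.
  rewrite /A [X in _ <= _ + X](bigD1 a)//=.
  have : 0 <= \sum_(i | i != a) \sum_q `|C i q| by do 2 apply: sumr_ge0 => ? _.
  lra.
pose ze := quad_iter al be C w K.
pose Q : {poly R} := l0%:P + l1%:P * 'X + \sum_q (l q)%:P * (ze (al q) * ze (be q)).
pose c := 2 * A * (4 * A ^+ 2) ^+ K.
have A2 : 0 < 8 * A ^+ 2 by rewrite mulr_gt0 ?exprn_gt0.
have Qlow i : (i < K.+2)%N -> Q`_i = 0.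
  apply: (@poly_low_coefs0 _ _ _ (8 * A ^+ 2)^-1 ((\sum_q `|l q|) * (2 * (2 * A) * c))).
    by rewrite invr_gt0.
  move=> t t0 te.
  have t1 : 8 * A ^+ 2 * `|t| <= 1 by rewrite gtr0_norm// mulrC -ler_pdivlMr ?div1r.
  have [z [zb zE]] := quad_solution_exists al be A0 wA CA t1.
  have zze a := quad_iter_approx A0 wA CA K a t1 zb zE.
  rewrite -[Q.[t]]subr0 -[X in Q.[t] - X](lP t z zE) /Q !(hornerD, hornerCM, hornerC, hornerX) horner_sum.
  rewrite opprD addrACA subrr add0r -sumrB.
  under eq_bigr => q _ do rewrite hornerCM hornerM -mulrBr.
  rewrite -(mulrA _ _ (t ^+ _)); apply: ler_norm_wsum => [||q].
  - have c0 : 0 <= c by rewrite mulr_ge0 ?exprn_ge0 ?mulr_ge0 ?exprn_ge0 ?(ltW A0).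
    by apply: mulr_ge0; [apply: mulr_ge0 => //; lra|apply: exprn_ge0; exact: ltW].
  - exact: lexx.
  - have b1 b : `|(ze b).[t]| <= 2 * A * `|t| by exact: quad_iter_bound.
    have d1 b : `|(ze b).[t] - z b| <= c * `|t| ^+ K.+1 by rewrite distrC; exact: zze.
    have := ler_norm_mulB (b1 _) (zb (be q)) (d1 (al q)) (d1 (be q)).
    move=> /le_trans; apply; rewrite gtr0_norm// (exprS t K.+1) le_eqVlt.
    by apply/orP; left; apply/eqP; ring.
(* The products start at order 2, so the coefficients of [Q] of order 0 and 1 are [l0] and [l1]. *)
have zz q : exists r, ze (al q) * ze (be q) = r * 'X * 'X.
  have [r rP] := quad_iter_dvdX C w K (al q).
  have [s sP] := quad_iter_dvdX C w K (be q).
  by exists (r * s); rewrite /ze rP sP; ring.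
have [r rP] := choice zz.
have Qi i : Q`_i = (l0%:P + l1%:P * 'X)`_i + \sum_q l q * (ze (al q) * ze (be q))`_i.
  by rewrite /Q coefD coef_sum; congr (_ + _); apply: eq_bigr => q _; rewrite coefCM.
split.
- rewrite -(Qlow 0%N)// Qi big1 ?coefD ?coefC ?coefMX/= ?addr0// => q _.
  by rewrite rP coefMX mulr0.
- rewrite -(Qlow 1%N)// Qi big1 ?coefD ?coefC ?coefMX ?coefC/= ?addr0 ?add0r// => q _.
  by rewrite rP !coefMX mulr0.
- pose v := \row_q l q.
  suff v0 : v = 0 by move=> q; have /rowP/(_ q) := v0; rewrite !mxE.
  have vH : v *m jet_mx al be C w = 0.
    apply/rowP => e; rewrite [RHS]mxE; transitivity Q`_e.+2; last by rewrite Qlow ?ltnS.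
    rewrite mxE Qi coefD coefC coefMX coefC/= !add0r.
    by apply: eq_bigr => q _; rewrite !mxE.
  have uH : jet_mx al be C w \in unitmx by rewrite unitmxE unitfE.
  by rewrite -(mulmxK uH v) vH mul0mx.
Qed.

(** The [i]-th iterate agrees with ['X^(ex a)] modulo ['X^(i.+1)]. A product gains one more order,
    so modulo ['X^(K.+2)] the product of index [q] is ['X^(q.+2)]. *)
Lemma jet_mx_monomial (ex : 'I_p -> nat) :
  (forall a, 0 < ex a <= K.+1)%N -> (forall q, ex (al q) + ex (be q) = q.+2)%N ->
  jet_mx al be (fun a q => (ex a == q.+2)%:R : R) (fun a => (ex a == 1%N)%:R) = 1%:M.
Proof.
move=> ex1 exq.
set C := fun a q => _; set w := fun a => _.
have solE a : 'X^(ex a) = (w a)%:P * 'X + \sum_q (C a q)%:P * 'X^(q.+2) :> {poly R}.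
  rewrite (monomial_solution (al := al) (be := be) ex1 exq) /quad_map mulrC polyC_natr.
  by congr (_ + _); apply: eq_bigr => q _; rewrite -exprD exq polyC_natr.
pose u a : {poly R} := 'X^((ex a).-1).
have uP a : 'X^(ex a) = u a * 'X by have /andP[? _] := ex1 a; rewrite -exprSr prednK.
have approx i a : exists r, quad_iter al be C w i a = 'X^(ex a) + r * 'X^(i.+1).
  elim: i a => [|i IH] a.
    have /andP[e0 _] := ex1 a; exists (- 'X^((ex a).-1)).
    by rewrite mulNr -exprD addn1 prednK// subrr.
  have [r rP] := choice IH; have [s sP] := choice (quad_iter_dvdX C w i).
  exists (\sum_q (C a q)%:P * (r (al q) * s (be q) + u (al q) * r (be q))).
  rewrite /quad_iter /= -/(quad_iter al be C w i) /quad_map solE -addrA mulrC.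
  congr (_ + _); rewrite mulr_suml -big_split/=; apply: eq_bigr => q _.
  have : quad_iter al be C w i (al q) * quad_iter al be C w i (be q) =
      'X^(ex (al q)) * 'X^(ex (be q)) + (u (al q) * 'X) * (r (be q) * 'X^(i.+1)) +
      (r (al q) * 'X^(i.+1)) * (s (be q) * 'X).
    rewrite -uP -sP [in LHS]rP mulrDl; congr (_ + _).
    by rewrite -mulrDr -rP.
  by move=> ->; rewrite -exprD exq (exprSr _ i.+1); ring.
apply/matrixP => q e; rewrite !mxE.
have [r ->] := approx K (al q); have [s ->] := approx K (be q).
rewrite mulrDl !mulrDr -exprD exq !uP -addrA.
rewrite [X in _ + X](_ : _ = (u (al q) * s + r * u (be q) + r * s * 'X^K) * 'X^(K.+2)).
  by rewrite coefD coefXn coefMXn !ltnS ltn_ord addr0 !eqSS eq_sym.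
by rewrite !exprS; ring.
Qed.

End jets.

(** * Zeros near the monomial curve *)

Lemma IVT_sign (R : realType) (f : R -> R) (a b L : R) : a <= b -> 0 <= L ->
  (forall x y, a <= x <= b -> a <= y <= b -> `|f x - f y| <= L * `|x - y|) ->
  f a * f b <= 0 -> exists2 c, a <= c <= b & f c = 0.
Proof.
move=> ab L0 fL fab.
have cf : {within `[a, b], continuous f}.
  apply/subspace_continuousP => x /=; rewrite in_itv/= => xab.
  apply/cvgrPdist_le => e e0; rewrite near_withinE.
  have d0 : 0 < e / (L + 1) by rewrite divr_gt0//; lra.
  near=> y => /=; rewrite in_itv/= => yab; apply: le_trans (fL _ _ xab yab) _.
  have : `|x - y| <= e / (L + 1).
    by near: y; apply/nbhs_ballP; exists (e / (L + 1)) => //= y; rewrite /ball/= => /ltW.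
  rewrite ler_pdivlMr; last lra.
  have := normr_ge0 (x - y); lra.
have /(IVT ab cf)[c] : Num.min (f a) (f b) <= 0 <= Num.max (f a) (f b).
  rewrite ge_min le_max; case: (lerP (f a) 0) => fa; case: (lerP (f b) 0) => fb//=.
  - have [//|fa'] := leP 0 (f a); have [//|fb'] := leP 0 (f b).
    by have := @nmulr_rgt0 _ (f a) (f b) fa'; rewrite fb' ltNge fab.
  - by rewrite (ltW fb) orbT.
  - by rewrite (ltW fa).
  - by have := mulr_gt0 fa fb; lra.
by rewrite in_itv/= => cab fc; exists c.
Unshelve. all: by end_near.
Qed.

Lemma det_neq0_open (R : realType) n (A : 'M[R]_n) : \det A != 0 ->
  exists2 e, 0 < e & forall B : 'M[R]_n, (forall i j, `|B i j - A i j| <= e) -> \det B != 0.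
Proof.
move=> dA.
(* Matrices become sequences, padded with [0], so that continuity of polynomial functions
   applies. *)
pose enc (B : 'M[R]_n) k := if insub k is Some p then mxvec B 0 p else 0.
have encE B i j : enc B (mxvec_index i j) = B i j by rewrite /enc valK mxvecE.
pose f x := \det (\matrix_(i < n, j < n) x (val (mxvec_index i j))) : R.
have fE B : f (enc B) = \det B.
  by congr (\det _); apply/matrixP => i j; rewrite mxE encE.
have pf : polyfun f.
  apply: polyfun_det => i j.
  by apply: polyfun_ext (polyfun_coord _ (mxvec_index i j)) => x; rewrite mxE.
have d0 : 0 < `|\det A| / 2 by rewrite divr_gt0// normr_gt0.
have [e e0 eP] := polyfun_continuous (enc A) pf d0.
exists e => // B BA.
have : `|f (enc B) - f (enc A)| <= `|\det A| / 2.
  apply: eP => k; rewrite /enc; case: insubP => [p _ _|_]; last by rewrite subrr normr0 ltW.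
  by case/mxvec_indexP: p => i j; rewrite !mxvecE.
rewrite !fE.
apply: contraTneq => ->; rewrite sub0r normrN -ltNge.
by rewrite ltr_pdivrMr// mulr_natr mulr2n ltrDl normr_gt0.
Qed.

Lemma powers_det_neq0 (R : realType) n (s : 'I_n -> R) :
  (forall i, s i != 0) -> injective s -> \det (\matrix_(i, j < n) s i ^+ j.+1) != 0.
Proof.
move=> s0 si; have -> : \matrix_(i, j < n) s i ^+ j.+1 =
    diag_mx (\row_i s i) *m (Vandermonde n (\row_i s i))^T.
  by apply/matrixP => i j; rewrite mul_diag_mx !mxE exprS.
rewrite det_mulmx det_diag det_tr det_Vandermonde mulf_neq0//.
  by apply/prodf_neq0 => i _; rewrite mxE.
apply/prodf_neq0 => i _; apply/prodf_neq0 => j ij; rewrite !mxE subr_eq0.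
by apply: contraTneq ij => /si ->; rewrite ltnn.
Qed.

Lemma ler_norm_expB (R : realType) (x y : R) n : `|x| <= 1 -> `|y| <= 1 ->
  `|x ^+ n - y ^+ n| <= n%:R * `|x - y|.
Proof.
move=> x1 y1; elim: n => [|n IH]; first by rewrite subrr normr0 mul0r.
rewrite !exprS (_ : x * x ^+ n - y * y ^+ n = x * (x ^+ n - y ^+ n) + (x - y) * y ^+ n).
  rewrite (le_trans (ler_normD _ _))// !normrM -natr1 mulrDl mul1r lerD//.
    by rewrite (le_trans _ IH)// ler_piMl.
  by rewrite ler_piMr// normrX exprn_ile1.
by ring.
Qed.

Section near_monomial_curve.
Variables (R : realType) (p K : nat) (al be : 'I_K -> 'I_p) (ex : 'I_p -> nat).
Hypotheses (ex_bound : forall a, (0 < ex a <= K.+1)%N)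
  (ex_sum : forall q, (ex (al q) + ex (be q) = q.+2)%N).

Let C0 a (q : 'I_K) : R := (ex a == q.+2)%:R.
Let w0 a : R := (ex a == 1%N)%:R.

Variables (d : R) (C : 'I_p -> 'I_K -> R) (w : 'I_p -> R).
Hypotheses (d0 : 0 <= d) (d1 : d * K.+1%:R <= 1)
  (Cd : forall a q, `|C a q - C0 a q| <= d) (wd : forall a, `|w a - w0 a| <= d).

Let dK : d * K%:R <= 1 - d.
Proof. by move: d1; rewrite -natr1 mulrDr mulr1; lra. Qed.

Let dle1 : d <= 1.
Proof. have h : 0 <= d * K%:R by rewrite mulr_ge0. by have := dK; lra. Qed.

Lemma near_monomial_w a : `|w a| <= 2.
Proof.
have := wd a; have : `|w0 a| <= 1 by rewrite /w0; case: eqP; rewrite ?normr1 ?normr0.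
by have := dle1; rewrite !ler_norml; lra.
Qed.

(** Each monomial equation has at most one quadratic term, and the perturbation adds at most
    [d * K <= 1]; hence the constant [A = 2] in what follows. *)
Lemma near_monomial_C a : \sum_q `|C a q| <= 2.
Proof.
have H : \sum_q `|C a q| <= \sum_q `|C0 a q| + \sum_(q < K) d.
  rewrite -big_split/=; apply: ler_sum => q _.
  by rewrite -{1}[C a q](subrK (C0 a q)) addrC (le_trans (ler_normD _ _))// lerD.
have C01 : \sum_q `|C0 a q| <= 1.
  have [[q aq]|nq] := pselect (exists q : 'I_K, ex a = q.+2).
    rewrite (bigD1 q)//= big1 ?addr0 /C0 ?aq ?eqxx ?normr1// => q' q'q.
    by rewrite !eqSS (_ : _ == _ = false) ?normr0//; apply/negbTE; rewrite eq_sym.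
  rewrite big1// => q _; rewrite /C0 (_ : _ == _ = false) ?normr0//.
  by apply/negbTE/eqP => aq; apply: nq; exists q.
move: H; rewrite sumr_const card_ord -[d *+ K]mulr_natr.
move: C01 dK; set u := d * _; set v := \sum_q `|C0 a q|; set s := \sum_q _; clearbody u v s; move: d0; lra.
Qed.

(** Stability with [A = 2] and [r = 1/8], so that [4 * A * r = 1]. At the monomial point the two
    systems differ by at most [d] for the linear term and [d] for each of the [K] products. *)
Lemma near_monomial_approx t z a : 32 * `|t| <= 1 -> (forall b, `|z b| <= 8^-1) ->
  (forall b, z b = quad_map al be C w t z b) ->
  `|z a - t ^+ ex a| <= 2 * (d * K.+1%:R).
Proof.
move=> t1 zb zE.
have t2 : `|t| <= 1 by lra.
apply: (quad_solution_stable (A := 2) (r := 8^-1)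
   _ near_monomial_C _ zb zE _ (monomial_solution ex_bound ex_sum t)) => //; first lra.
  move=> b; have /andP[e0 _] := ex_bound b.
  rewrite normrX -(prednK e0) exprS.
  have : `|t| ^+ (ex b).-1 <= 1 by rewrite exprn_ile1.
  by move=> h; have := ler_wpM2l (normr_ge0 t) h; lra.
move=> b; rewrite /quad_map opprD addrACA -mulrBr -sumrB.
under eq_bigr => q _ do rewrite -mulrBl -exprD.
have -> : d * K.+1%:R = d + d * K%:R by rewrite -[K.+1%:R]natr1 mulrDr mulr1 addrC.
rewrite (le_trans (ler_normD _ _))// lerD//.
  by rewrite normrM (le_trans _ (wd b))// ler_piMl.
rewrite (le_trans (ler_norm_sum _ _ _))//.
rewrite (@le_trans _ _ (\sum_(q < K) d))//; last by rewrite sumr_const card_ord mulr_natr.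
by apply: ler_sum => q _; rewrite normrM (le_trans _ (Cd b q))// ler_piMr// normrX exprn_ile1.
Qed.

Lemma near_monomial_lip t t' z z' a :
  (forall b, `|z b| <= 8^-1) -> (forall b, z b = quad_map al be C w t z b) ->
  (forall b, `|z' b| <= 8^-1) -> (forall b, z' b = quad_map al be C w t' z' b) ->
  `|z a - z' a| <= 4 * `|t - t'|.
Proof.
move=> zb zE zb' zE'.
have -> : 4 * `|t - t'| = 2 * (2 * `|t - t'|) by ring.
apply: (quad_solution_stable (A := 2) (r := 8^-1)
   _ near_monomial_C _ zb zE zb' zE') => //; first lra.
move=> b; rewrite /quad_map opprD addrACA subrr addr0 -mulrBl normrM mulrC.
by rewrite ler_wpM2r// near_monomial_w.
Qed.

Lemma near_monomial_exists t : 32 * `|t| <= 1 -> exists z,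
  (forall b, `|z b| <= 8^-1) /\ (forall b, z b = quad_map al be C w t z b).
Proof.
move=> t1; have [||z [zb zE]] := @quad_solution_exists R p K al be C w 2 _ near_monomial_w near_monomial_C t.
- by [].
- by rewrite (_ : 8 * 2 ^+ 2 = 32)//; ring.
exists z; split=> // b; apply: le_trans (zb b) _; lra.
Qed.

End near_monomial_curve.

Lemma ler_norm_mul_gt0 (R : realType) (x y m : R) :
  m < `|y| -> `|x - y| <= m -> 0 < x * y.
Proof.
move=> my xy; case: (ltrgt0P y) my => [y0|y0|->] my.
- by rewrite pmulr_lgt0//; move: xy; rewrite ler_norml; lra.
- by rewrite nmulr_lgt0//; move: xy; rewrite ler_norml; lra.
- by have := le_trans (normr_ge0 _) xy; move: my; rewrite ?normr0; lra.
Qed.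

(** Pairing the factors at [s r - x] and [s r + x], the pair of index [r] gives [- (x / s r) ^+ 2],
    and every other pair is positive because its root is farther than [x] from [s r]. *)
Lemma simple_roots_sign (R : realType) n (s : 'I_n -> R) (r : 'I_n) (x : R) :
  0 < x -> (forall i, s i != 0) -> (forall i, i != r -> x < `|s i - s r|) ->
  (- \prod_i (1 - (s i)^-1 * (s r - x))) * (- \prod_i (1 - (s i)^-1 * (s r + x))) < 0.
Proof.
move=> x0 s0 sx; rewrite mulrNN -big_split/= (bigD1 r)//=.
rewrite pmulr_llt0.
  have -> : (1 - (s r)^-1 * (s r - x)) * (1 - (s r)^-1 * (s r + x)) = - (x / s r) ^+ 2.
    by field; exact: s0.
  by rewrite oppr_lt0 exprn_even_gt0//= mulf_neq0 ?invr_neq0 ?s0// gt_eqF.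
apply: prodr_gt0 => i ir.
have -> : (1 - (s i)^-1 * (s r - x)) * (1 - (s i)^-1 * (s r + x)) =
    (s i)^-1 ^+ 2 * (`|s i - s r| ^+ 2 - x ^+ 2).
  by rewrite real_normK ?num_real//; field; exact: s0.
rewrite mulr_gt0 ?exprn_even_gt0 ?invr_neq0 ?s0//= subr_gt0 ltrXn2r//.
- exact: ltW.
- exact: sx.
Qed.

Lemma dist_natr_ge1 (R : numDomainType) (a b : nat) : a != b -> 1 <= `|a%:R - b%:R : R|.
Proof.
wlog ab : a b / (a < b)%N => [H ab|_].
  by case: (ltngtP a b) (ab) => // h _; [|rewrite distrC]; apply: H; rewrite // eq_sym.
by rewrite distrC -natrB ?normr_nat ?ler1n ?subn_gt0// ltnW.
Qed.

Section zeros_persist.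
Variables (R : realType) (p K : nat) (al be : 'I_K -> 'I_p) (ex : 'I_p -> nat).
Hypotheses (ex_bound : forall a, (0 < ex a <= K.+1)%N)
  (ex_sum : forall q, (ex (al q) + ex (be q) = q.+2)%N).

(** With this step all nodes, and even one step past the last, stay in the range [32 * |t| <= 1]
    where solutions exist. *)
Let step : R := (32 * K.+2%:R)^-1.
Let node (r : 'I_K.+1) : R := r.+1%:R * step.

Let step0 : 0 < step. Proof. by rewrite invr_gt0 mulr_gt0// ltr0n. Qed.

Let node_gt0 r : 0 < node r. Proof. by rewrite mulr_gt0// ltr0n. Qed.

Let stepE : 32 * (K.+2%:R * step) = 1.
Proof. by rewrite mulrA mulfV// mulf_neq0// pnatr_eq0. Qed.

Let node_lt r : 32 * (node r + step) <= 1.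
Proof.
have h : node r + step <= K.+2%:R * step.
  by rewrite /node -{2}[step]mul1r -mulrDl ler_pM2r// natr1 ler_nat ltnS ltn_ord.
by have := stepE; lra.
Qed.

Let node_sep r r' : r != r' -> step <= `|node r - node r'|.
Proof.
move=> rr; rewrite /node -mulrBl normrM (gtr0_norm step0).
have h : 1 <= `|r.+1%:R - r'.+1%:R : R|.
  by apply: dist_natr_ge1; apply: contraNneq rr => -[rr]; apply/eqP/val_inj.
by have := ler_wpM2r (ltW step0) h; rewrite mul1r.
Qed.

(** Simple zeros at the nodes and constant term [-1]; the other coefficients serve as the centers
    [g1] and [g]. *)
Let P : {poly R} := - \prod_r (1 - (node r)^-1 *: 'X).

Let P_horner t : P.[t] = - \prod_r (1 - (node r)^-1 * t).
Proof.
rewrite /P hornerN horner_prod; congr (- _); apply: eq_bigr => r _.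
by rewrite !hornerE.
Qed.

Let P_expand t : P.[t] = -1 + P`_1 * t + \sum_(q < K) P`_q.+2 * t ^+ q.+2.
Proof.
have sP : (size P <= K.+2)%N.
  rewrite /P size_polyN (leq_trans (size_poly_prod_leq _ _))// cardT size_enum_ord.
  have h r : (size (1 - (node r)^-1 *: 'X : {poly R})%R <= 2)%N.
    rewrite (leq_trans (size_polyD _ _))// geq_max size_poly1 size_polyN/=.
    by rewrite (leq_trans (size_scale_leq _ _))// size_polyX.
  rewrite (@leq_trans ((\sum_(r < K.+1) 2).+1 - K.+1)%N) ?leq_sub2r ?ltnS ?leq_sum//.
  by rewrite sum_nat_const card_ord; lia.
rewrite (horner_coef_wide _ sP) !big_ord_recl/= !expr0 expr1 mulr1 addrA.
congr (_ + _ * _ + _).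
rewrite -horner_coef0 P_horner; congr (- _).
by rewrite big1// => r _; rewrite mulr0 subr0.
Qed.

Let curve_eq (C : 'I_p -> 'I_K -> R) w t z :=
  forall a, z a = quad_map al be C w t z a.

(* The hyperplane section of the monomial curve by [P] consists of the [K + 1]
   simple points with parameters [node r]; simple zeros survive perturbation. *)
Lemma curve_zeros_persist : exists (g1 : R) (g : 'I_K -> R) (d : R), 0 < d /\
  forall (C : 'I_p -> 'I_K -> R) w f1 (f : 'I_K -> R),
    (forall a q, `|C a q - (ex a == q.+2)%:R| <= d) ->
    (forall a, `|w a - (ex a == 1%N)%:R| <= d) ->
    `|f1 - g1| <= d -> (forall q, `|f q - g q| <= d) ->
  forall l1 l, (forall t z, curve_eq C w t z ->
      -1 + f1 * t + \sum_q f q * (z (al q) * z (be q)) = 0 ->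
      l1 * t + \sum_q l q * (z (al q) * z (be q)) = 0) ->
  l1 = 0 /\ forall q, l q = 0.
Proof.
have k1 : 1 <= K.+1%:R :> R by rewrite ler1n.
have k2 : 1 <= K.+2%:R :> R by rewrite ler1n.
have dA : \det (\matrix_(i, j < K.+1) node i ^+ j.+1) != 0.
  apply: powers_det_neq0 => [i|i j ij]; first by rewrite gt_eqF.
  apply/eqP; apply: contraT => /node_sep; rewrite ij subrr normr0.
  by rewrite leNgt step0.
have [eta eta0 etaP] := det_neq0_open dA.
(* Half-width of the interval around each node: [step / 2] excludes the other nodes, and the second
   bound keeps powers of [t] within [eta / 2] of powers of the node. *)
pose xi := Num.min (step / 2) (eta / (2 * K.+2%:R)).
have xi0 : 0 < xi by rewrite lt_min !divr_gt0// mulr_gt0//; lra.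
have xi_step : xi <= step / 2 by rewrite /xi ge_min lexx.
have xi_eta : K.+2%:R * xi <= eta / 2.
  have h : xi <= eta / (2 * K.+2%:R) by rewrite /xi ge_min lexx orbT.
  apply: le_trans (ler_wpM2l (le_trans ler01 k2) h) _.
  by rewrite le_eqVlt; apply/orP; left; apply/eqP; field; lra.
(* At most half of [|P|] at every interval end, so an error of [mu] preserves the signs there. *)
pose mu := \big[Order.Def.min/1]_r
  Num.min (`|P.[node r - xi]| / 2) (`|P.[node r + xi]| / 2).
have Psign r : P.[node r - xi] * P.[node r + xi] < 0.
  rewrite !P_horner; apply: simple_roots_sign => // [i|i ir].
    by rewrite gt_eqF.
  by apply: lt_le_trans (node_sep ir); move: step0; lra.
have mu0 : 0 < mu.
  apply: lt_bigmin => // r _; have /ltr0_neq0 := Psign r.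
  rewrite mulf_eq0 negb_or => /andP[h1 h2].
  by rewrite lt_min; apply/andP; split; rewrite divr_gt0// normr_gt0.
have mu_lt r : mu < `|P.[node r - xi]| /\ mu < `|P.[node r + xi]|.
  have := bigmin_le 1 r (fun r => Num.min (`|P.[node r - xi]| / 2) (`|P.[node r + xi]| / 2)).
  by rewrite -/mu le_min => /andP[]; move: mu0; lra.
pose F := `|P`_1| + \sum_(q < K) `|P`_q.+2|.
have F0 : 0 <= F by rewrite addr_ge0// sumr_ge0.
pose Gam := K.+1%:R * (1 + K.+1%:R * F).
have Gam1 : 1 <= Gam.
  have KF : 0 <= K.+1%:R * F by rewrite mulr_ge0.
  by rewrite /Gam (le_trans k1)// ler_peMr//; lra.
(* The three bounds give, in order, the estimates near the monomial curve, matrix entries within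
   [eta], and [G] within [mu] of [P]. *)
pose d := Num.min (K.+1%:R^-1) (Num.min (eta / K.+1%:R) (mu / Gam)).
have d0 : 0 < d by rewrite !lt_min invr_gt0 !divr_gt0//; lra.
have d1 : d * K.+1%:R <= 1.
  by rewrite -ler_pdivlMr ?div1r ?ge_min ?lexx//; lra.
have d_eta : d * K.+1%:R <= eta.
  by rewrite -ler_pdivlMr ?ge_min ?lexx ?orbT//; lra.
have d_mu : d * Gam <= mu.
  by rewrite -ler_pdivlMr ?ge_min ?lexx ?orbT//; lra.
exists P`_1, (fun q : 'I_K => P`_q.+2), d; split=> // C w f1 f Cd wd f1d fd l1 l lP.
have dw := ltW d0.
have /choice[ze zeP] : forall t, exists z : 'I_p -> R, 32 * `|t| <= 1 ->
    (forall b, `|z b| <= 8^-1) /\ curve_eq C w t z.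
  move=> t; have [t1|t1] := pselect (32 * `|t| <= 1); last by exists (fun=> 0).
  have [z zP] := near_monomial_exists al be dw d1 Cd wd t1.
  by exists z => _.
pose h t q : R := ze t (al q) * ze t (be q).
have h1 t q : 32 * `|t| <= 1 -> `|h t q| <= 1.
  move=> /zeP[zb _]; rewrite normrM -[1]mulr1 ler_pM// (le_trans (zb _))//; lra.
have h_approx t q : 32 * `|t| <= 1 -> `|h t q - t ^+ q.+2| <= d * K.+1%:R / 2.
  move=> t1; have [zb zE] := zeP t t1; rewrite -ex_sum exprD.
  have za a := near_monomial_approx ex_bound ex_sum dw d1 Cd wd a t1 zb zE.
  have tb a : `|t ^+ ex a| <= 8^-1.
    have /andP[e0 _] := ex_bound a; rewrite normrX -(prednK e0) exprS.
    have t1' : `|t| ^+ (ex a).-1 <= 1 by rewrite exprn_ile1//; lra.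
    by have := ler_wpM2l (normr_ge0 t) t1'; lra.
  rewrite (le_trans (ler_norm_mulB (zb _) (tb _) (za _) (za _)))//.
  by rewrite le_eqVlt; apply/orP; left; apply/eqP; field.
have h_lip t t' q : 32 * `|t| <= 1 -> 32 * `|t'| <= 1 -> `|h t q - h t' q| <= `|t - t'|.
  move=> /zeP[zb zE] /zeP[zb' zE'].
  have zl a := near_monomial_lip dw d1 Cd wd a zb zE zb' zE'.
  rewrite (le_trans (ler_norm_mulB (zb _) (zb' _) (zl _) (zl _)))//.
  by rewrite le_eqVlt; apply/orP; left; apply/eqP; field.
(* The hyperplane equation along the perturbed curve; it inherits the sign changes of [P]. *)
pose G t := -1 + f1 * t + \sum_q f q * h t q.
have GP t : 32 * `|t| <= 1 -> `|G t - P.[t]| <= mu.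
  move=> t1; apply: le_trans d_mu; rewrite P_expand /G.
  have -> : -1 + f1 * t + \sum_q f q * h t q -
      (-1 + P`_1 * t + \sum_(q < K) P`_q.+2 * t ^+ q.+2) =
      (f1 - P`_1) * t + \sum_q (f q * h t q - P`_q.+2 * t ^+ q.+2).
    by rewrite sumrB; ring.
  have H1 : `|(f1 - P`_1) * t| <= d by rewrite normrM (le_trans _ f1d)// ler_piMr//; lra.
  have H2 q : `|f q * h t q - P`_q.+2 * t ^+ q.+2| <= d + `|P`_q.+2| * (d * K.+1%:R / 2).
    have -> : f q * h t q - P`_q.+2 * t ^+ q.+2 =
      (f q - P`_q.+2) * h t q + P`_q.+2 * (h t q - t ^+ q.+2) by ring.
    rewrite (le_trans (ler_normD _ _))// lerD//.
      by rewrite (normrM _ (h t q)) (le_trans _ (fd q))// ler_piMr// h1.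
    by rewrite normrM ler_wpM2l// h_approx.
  have H3 : `|\sum_q (f q * h t q - P`_q.+2 * t ^+ q.+2)| <=
      d * K%:R + (\sum_(q < K) `|P`_q.+2|) * (d * K.+1%:R / 2).
    rewrite (le_trans (ler_norm_sum _ _ _))// (le_trans (ler_sum _ (fun q _ => H2 q)))//.
    by rewrite big_split/= sumr_const card_ord -[d *+ K]mulr_natr mulr_suml.
  have H4 : \sum_(q < K) `|P`_q.+2| <= F by rewrite lerDr.
  have H5 : (\sum_(q < K) `|P`_q.+2|) * (d * K.+1%:R / 2) <= F * (d * K.+1%:R).
    by apply: ler_pM => //; [rewrite sumr_ge0|rewrite divr_ge0// mulr_ge0|
      rewrite ler_pdivrMr// ler_peMr ?mulr_ge0//; lra].
  have H6 : F * (d * K.+1%:R) <= F * (d * K.+1%:R) * K.+1%:R.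
    by rewrite ler_peMr// mulr_ge0// mulr_ge0.
  have H7 : d * Gam = d + d * K%:R + F * (d * K.+1%:R) * K.+1%:R.
    by rewrite /Gam -[K.+1%:R]natr1; ring.
  rewrite H7 (le_trans (ler_normD _ _))//.
  by move: H1 H3 H5 H6; lra.
have Glip x y : 32 * `|x| <= 1 -> 32 * `|y| <= 1 ->
    `|G x - G y| <= (`|f1| + \sum_q `|f q|) * `|x - y|.
  move=> x1 y1.
  have -> : G x - G y = f1 * (x - y) + \sum_q f q * (h x q - h y q).
    rewrite /G; under [in RHS]eq_bigr do rewrite mulrBr.
    by rewrite sumrB; ring.
  rewrite (le_trans (ler_normD _ _))// normrM mulrDl lerD2l.
  by apply: ler_norm_wsum => // q; exact: h_lip.
have dom r t : node r - xi <= t <= node r + xi -> 32 * `|t| <= 1.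
  move=> /andP[t1 t2]; have := node_lt r; have := node_gt0 r.
  have : step <= node r by rewrite /node ler_peMl ?(ltW step0)// ler1n.
  by move: step0 => s0 ns n0 n1; rewrite ger0_norm; lra.
have /choice[tt ttP] : forall r : 'I_K.+1, exists x,
    node r - xi <= x <= node r + xi /\ G x = 0.
  move=> r.
  have xx : node r - xi <= node r + xi by lra.
  have b1 : node r - xi <= node r - xi <= node r + xi by rewrite lexx.
  have b2 : node r - xi <= node r + xi <= node r + xi by rewrite lexx xx.
  have [|x y xr yr||c cr Gc] := @IVT_sign R G _ _ (`|f1| + \sum_q `|f q|) xx.
  - by rewrite addr_ge0// sumr_ge0.
  - by apply: Glip; [exact: dom xr|exact: dom yr].
  - have s1 := ler_norm_mul_gt0 (mu_lt r).1 (GP _ (dom _ _ b1)).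
    have s2 := ler_norm_mul_gt0 (mu_lt r).2 (GP _ (dom _ _ b2)).
    have := mulr_gt0 s1 s2; rewrite mulrACA nmulr_lgt0 ?Psign//; exact: ltW.
  - by exists c.
(* Row [r] evaluates [t] and the products at the zero near [node r]. It is within [eta] of the
   powers of [node r], so [A] is invertible and a form vanishing at all the zeros is [0]. *)
pose A : 'M[R]_K.+1 := \matrix_(r, e) oapp (h (tt r)) (tt r) (unlift ord0 e).
have tn r : `|tt r - node r| <= xi by have [/andP[? ?] _] := ttP r; rewrite ler_norml; lra.
have t32 r : 32 * `|tt r| <= 1 by have [+ _] := ttP r; exact: dom.
have n1 r : `|node r| <= 1.
  by have := node_lt r; have := step0; rewrite (gtr0_norm (node_gt0 r)); lra.
have uA : A \in unitmx.
  rewrite unitmxE unitfE; apply: etaP => r e; rewrite !mxE.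
  have tnp k : (k <= K.+2)%N -> `|tt r ^+ k - node r ^+ k| <= eta / 2.
    move=> kK; apply: le_trans xi_eta.
    rewrite (le_trans (ler_norm_expB _ _ _))//; first by have := t32 r; lra.
    by rewrite ler_pM// ler_nat.
  case: (unliftP ord0 e) => [q|] -> /=.
    have := h_approx (tt r) q (t32 r); have := tnp q.+2.
    rewrite /bump/= add1n => /(_ _)/le_trans-/(_ _ _ (lexx _)) B1 B2.
    have {}B1 := B1 (leqW (ltn_ord q)).
    by move: B1 B2 d_eta; rewrite !ler_norml; lra.
  by have := tnp 1%N; rewrite expr1 => /(_ isT) /le_trans; apply; lra.
pose v : 'cV[R]_K.+1 := \col_e oapp l l1 (unlift ord0 e).
have v0 : v = 0.
  suff Av : A *m v = 0 by rewrite -(mulKmx uA v) Av mulmx0.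
  apply/colP => r; rewrite !mxE big_ord_recl !mxE unlift_none/=.
  have [_ Gr] := ttP r; rewrite -[RHS](lP (tt r) (ze (tt r)) (zeP _ (t32 r)).2 Gr).
  rewrite mulrC; congr (_ + _); apply: eq_bigr => q _.
  by rewrite !mxE liftK/= mulrC.
split; first by have /colP/(_ ord0) := v0; rewrite !mxE unlift_none.
by move=> q; have /colP/(_ (lift ord0 q)) := v0; rewrite !mxE liftK.
Qed.

End zeros_persist.

(** * The curve of rank-one matrices attached to a tensor *)

Section slices.
Variables (R : realType) (M N : nat).
Hypotheses (M0 : (0 < M)%N).
Local Notation K := (M * N)%N.
Local Notation p := (M + N)%N.
Implicit Types (T : nat -> nat -> nat -> R) (c : nat).

Fact left_index_subproof (q : 'I_K) : (q %% M < p)%N.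
Proof. by rewrite ltn_addr// ltn_mod. Qed.
Definition left_index q : 'I_p := Ordinal (left_index_subproof q).

Fact right_index_subproof (q : 'I_K) : (M + q %/ M < p)%N.
Proof. by rewrite ltn_add2l ltn_divLR// [X in (_ < X)%N]mulnC. Qed.
Definition right_index q : 'I_p := Ordinal (right_index_subproof q).

(* The entry [(0, 0)] of a rank-one matrix is normalised to 1; the remaining
   entries of its first column and first row are the coordinates indexed by
   ['I_(M + N)], and the entry [(i.+1, j.+1)] is indexed by [i + M * j]. *)
Definition row_of (a : nat) := if (a < M)%N then a.+1 else 0%N.
Definition col_of (a : nat) := if (a < M)%N then 0%N else (a - M).+1.

Definition inner_mx T : 'M[R]_K := \matrix_(q, k) T (q %% M).+1 (q %/ M).+1 k.
Definition inner_col T c : 'cV[R]_K := \col_q T (q %% M).+1 (q %/ M).+1 c.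

(* Cramer's rule without the division by [\det (inner_mx T)], so that everything
   stays polynomial in the entries of [T]: this is why powers of that
   determinant appear in [curve_coef] and [curve_point]. *)
Definition cramer T (mu : nat -> R) (q : 'I_K) : R :=
  \sum_(k < K) mu k * \adj (inner_mx T) k q.
Definition cramer1 T c (mu : nat -> R) : R :=
  \det (inner_mx T) * mu c - \sum_q cramer T mu q * inner_col T c q 0.

Definition curve_C T (a : 'I_p) := cramer T (T (row_of a) (col_of a)).
Definition curve_w T c (a : 'I_p) := cramer1 T c (T (row_of a) (col_of a)).

(** Slice [c] receives the weight [\det (inner_mx T) ^+ 2 * t]; the slices below [K] are then
    weighted so that every inner entry of the combination is the product of its two coordinates,
    times the same squared determinant. *)
Definition curve_coef T c t (z : 'I_p -> R) (k : nat) : R :=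
  (if insub k is Some k' then
     \det (inner_mx T) * (\sum_q \adj (inner_mx T) k' q *
        (z (left_index q) * z (right_index q) - t * inner_col T c q 0))
   else 0) + (if k == c then \det (inner_mx T) ^+ 2 * t else 0).

(** Used both for [mu] an entry of the slices and for [mu] the values of a functional on them. *)
Lemma curve_coef_sum l T c t z (mu : nat -> R) : (K <= c < l)%N ->
  \sum_(k < l) curve_coef T c t z k * mu k =
  \det (inner_mx T) * (cramer1 T c mu * t +
    \sum_q cramer T mu q * (z (left_index q) * z (right_index q))).
Proof.
move=> /andP[Kc hc]; have Kl : (K <= l)%N by rewrite ltnW// (leq_ltn_trans Kc).
under eq_bigr do rewrite mulrDl; rewrite big_split/=.
rewrite (bigID (fun k : 'I_l => (k < K)%N))/= [X in _ + X + _]big1 ?addr0; last first.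
  by move=> k kK; rewrite insubF ?mul0r//; apply/negbTE.
rewrite (big_ord_narrow Kl)/= [X in _ + X](bigD1 (Ordinal hc))//= eqxx.
rewrite [X in _ + (_ + X)]big1 ?addr0; last first.
  by move=> k kc; rewrite (_ : _ == _ = false) ?mul0r//; apply/negbTE.
set S := \sum_(i < K) _.
have -> : S = \sum_(k < K) \det (inner_mx T) * \sum_q \adj (inner_mx T) k q *
    (z (left_index q) * z (right_index q) - t * inner_col T c q 0) * mu k.
  apply: eq_bigr => k _; rewrite insubT//= => kK.
  by rewrite (_ : Sub _ _ = k) -?mulrA ?mulr_suml//; apply/val_inj.
rewrite -mulr_sumr exchange_big/= /cramer1.
have -> : \sum_(q < K) \sum_(k < K) \adj (inner_mx T) k q *
    (z (left_index q) * z (right_index q) - t * inner_col T c q 0) * mu k =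
    \sum_q cramer T mu q * (z (left_index q) * z (right_index q)) -
    (\sum_q cramer T mu q * inner_col T c q 0) * t.
  rewrite mulr_suml -sumrB; apply: eq_bigr => q _.
  rewrite /cramer !mulr_suml -sumrB; apply: eq_bigr => k _; ring.
ring.
Qed.

Lemma cramer_inner T (q q' : 'I_K) :
  cramer T (T (q %% M).+1 (q %/ M).+1) q' = \det (inner_mx T) *+ (q == q').
Proof.
transitivity ((inner_mx T *m \adj (inner_mx T)) q q'); last by rewrite mul_mx_adj mxE.
by rewrite mxE; apply: eq_bigr => k _; rewrite [X in _ = X * _]mxE.
Qed.

Lemma cramer1_inner T c (q : 'I_K) :
  cramer1 T c (T (q %% M).+1 (q %/ M).+1) = 0.
Proof.
rewrite /cramer1 (bigD1 q)//= cramer_inner eqxx mulr1n big1 => [|q' qq'].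
  by rewrite mxE addr0 subrr.
by rewrite cramer_inner eq_sym (negbTE qq') mul0r.
Qed.

(** Since [inner_mx T] is invertible, Cramer's rule can be undone. *)
Lemma cramer_eq0 T c (mu : nat -> R) : \det (inner_mx T) != 0 ->
  cramer1 T c mu = 0 -> (forall q, cramer T mu q = 0) ->
  (forall k, (k < K)%N -> mu k = 0) /\ mu c = 0.
Proof.
move=> dT c1 c0; split; last first.
  move: c1; rewrite /cramer1 big1 => [|q _]; last by rewrite c0 mul0r.
  by rewrite subr0 => /eqP; rewrite mulf_eq0 (negbTE dT) => /eqP.
have m0 : (\row_(k < K) mu k) *m \adj (inner_mx T) = 0.
  apply/rowP => q; rewrite [RHS]mxE -(c0 q) mxE.
  by apply: eq_bigr => k _; rewrite [X in X * _]mxE.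
have : (\row_(k < K) mu k) *m \adj (inner_mx T) *m inner_mx T = 0 by rewrite m0 mul0mx.
rewrite -mulmxA mul_adj_mx mul_mx_scalar => /eqP; rewrite scaler_eq0 (negbTE dT) => /eqP mu0.
by move=> k kK; have /rowP/(_ (Ordinal kK)) := mu0; rewrite !mxE.
Qed.

Definition curve_point T (z : 'I_p -> R) (a : nat) : R :=
  if insub a is Some a' then \det (inner_mx T) * z a' else 0.

Definition left_vec T z (i : nat) : R := if i is i'.+1 then curve_point T z i' else 1.
Definition right_vec T z (j : nat) : R := if j is j'.+1 then curve_point T z (M + j') else 1.

Lemma curve_pointE T z (a : 'I_p) : curve_point T z a = \det (inner_mx T) * z a.
Proof. by rewrite /curve_point valK. Qed.

(** On the first row and column this is the quadratic system itself; at inner entries it holds by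
    the choice of the weights. Only the entry [(0, 0)] is left out. *)
Lemma curve_rank_one l T c t z (i j : nat) : (K <= c < l)%N ->
  (forall a, z a = quad_map left_index right_index (curve_C T) (curve_w T c) t z a) ->
  (i <= M)%N -> (j <= N)%N -> (0 < i + j)%N ->
  left_vec T z i * right_vec T z j = \sum_(k < l) curve_coef T c t z k * T i j k.
Proof.
move=> hc zE iM jN ij.
have lin (a : 'I_p) : \sum_(k < l) curve_coef T c t z k * T (row_of a) (col_of a) k =
    curve_point T z a.
  by rewrite curve_coef_sum// curve_pointE [in RHS]zE /quad_map [in RHS](mulrC t).
case: i j iM jN ij => [|i] [|j]//= iM jN _.
- have aP : (M + j < p)%N by rewrite ltn_add2l.
  have := lin (Ordinal aP); rewrite /row_of /col_of/= ltnNge leq_addr/= addKn => ->.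
  by rewrite mul1r.
- have aP : (i < p)%N by rewrite ltn_addr.
  have := lin (Ordinal aP); rewrite /row_of /col_of/= iM => ->.
  by rewrite mulr1.
- have qP : (i + M * j < K)%N by nia.
  pose q := Ordinal qP.
  have qi : (q %% M)%N = i by rewrite /= addnC mulnC modnMDl modn_small.
  have qj : (q %/ M)%N = j by rewrite /= addnC mulnC divnMDl// divn_small ?addn0.
  have -> : T i.+1 j.+1 = T (q %% M).+1 (q %/ M).+1 by rewrite qi qj.
  rewrite curve_coef_sum// cramer1_inner mul0r add0r (bigD1 q)// big1; last first.
    by move=> q' /andP[_ q'q]; rewrite cramer_inner eq_sym (negbTE q'q) mul0r.
  rewrite cramer_inner eqxx mulr1n /= addr0.
  rewrite -[in LHS]qi -[in LHS]qj.
  rewrite (curve_pointE T z (left_index q)) (curve_pointE T z (right_index q)).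
  ring.
Qed.

End slices.

(** * Rank bounds from the curve *)

Section rank_bounds.
Variables (R : realType) (M N l : nat).
Hypotheses (M0 : (0 < M)%N).
Local Notation K := (M * N)%N.
Hypothesis (Kl : (K < l)%N).
Variable T : nat -> nat -> nat -> R.
Hypothesis (dT : \det (inner_mx M N T) != 0).

Let TT : tensor R M.+1 N.+1 l := fun i j k => T i j k.
Let al := @left_index M N M0.
Let be := @right_index M N M0.

Let on_curve c t (z : 'I_(M + N) -> R) :=
  forall a, z a = quad_map al be (curve_C (N := N) T) (curve_w (N := N) T c) t z a.

(** The defect at entry [(0, 0)]: the rank-one matrix is a combination of slices plus [corner] times
    the matrix unit. *)
Let corner c t (z : 'I_(M + N) -> R) := 1 - \sum_(k < l) curve_coef M0 T c t z k * T 0 0 k.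

Lemma curve_rank_one_corner c t z : (K <= c < l)%N -> on_curve c t z ->
  forall (i : 'I_M.+1) (j : 'I_N.+1), left_vec T z i * right_vec T z j =
    corner c t z * ((i == ord0) && (j == ord0))%:R +
    \sum_(k < l) curve_coef M0 T c t z k * TT i j k.
Proof.
move=> hc zE i j; have [ij|ij] := boolP ((i == ord0) && (j == ord0)).
  have /andP[/eqP -> /eqP ->] := ij.
  by rewrite /= /corner mulr1 mulr1 subrK.
rewrite mulr0 add0r; apply: curve_rank_one => //; first by rewrite -ltnS.
  by rewrite -ltnS.
by rewrite lt0n addn_eq0.
Qed.

Lemma pairing_sum (I : finType) (u : 'I_M.+1 -> 'I_N.+1 -> R) (c : I -> R)
    (B : I -> 'I_M.+1 -> 'I_N.+1 -> R) :
  pairing u (fun i j => \sum_r c r * B r i j) = \sum_r c r * pairing u (B r).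
Proof.
rewrite /pairing; under [RHS]eq_bigr do rewrite mulr_sumr.
rewrite [RHS]exchange_big/=; apply: eq_bigr => i _.
under [RHS]eq_bigr do rewrite mulr_sumr.
rewrite [RHS]exchange_big/=; apply: eq_bigr => j _.
by rewrite mulr_sumr; apply: eq_bigr => r _; rewrite mulrCA.
Qed.

Lemma pairingD (u B B' : 'I_M.+1 -> 'I_N.+1 -> R) :
  pairing u (fun i j => B i j + B' i j) = pairing u B + pairing u B'.
Proof.
rewrite /pairing -big_split/=; apply: eq_bigr => i _.
by rewrite -big_split/=; apply: eq_bigr => j _; rewrite mulrDr.
Qed.

Lemma pairing_corner (u : 'I_M.+1 -> 'I_N.+1 -> R) (x : R) :
  pairing u (fun i j => x * ((i == ord0) && (j == ord0))%:R) = x * u ord0 ord0.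
Proof.
rewrite /pairing (bigD1 ord0)//= [X in _ + X]big1 ?addr0 => [|i i0].
  rewrite (bigD1 ord0)//= [X in _ + X]big1 ?addr0 => [|j j0]; first by rewrite mulr1 mulrC.
  by rewrite (negbTE j0) !mulr0.
by rewrite big1// => j _; rewrite (negbTE i0) !mulr0.
Qed.

Let mu u (k : nat) := pairing u (fun (i : 'I_M.+1) (j : 'I_N.+1) => T i j k).

Lemma pairing_curve u c t z : (K <= c < l)%N -> on_curve c t z ->
  pairing u (fun i j => left_vec T z i * right_vec T z j) =
  corner c t z * u ord0 ord0 + \sum_(k < l) curve_coef M0 T c t z k * mu u k.
Proof.
move=> hc zE; rewrite /pairing.
under eq_bigr do under eq_bigr do rewrite (curve_rank_one_corner hc zE).
by rewrite -/(pairing _ _) pairingD pairing_corner pairing_sum.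
Qed.

(** A functional vanishing on the curve of slice [c] gives a relation whose constant term is its
    value on the matrix unit. Nondegeneracy kills it there, on the slices below [K] and on slice
    [c]; then [c] varies. *)
Lemma rank_le_generic :
  (forall c, (K <= c < l)%N ->
    \det (jet_mx al be (curve_C (N := N) T) (curve_w (N := N) T c)) != 0) ->
  rank_le TT l.+1.
Proof.
move=> dH; pose B (r : 'I_l.+1) (i : 'I_M.+1) (j : 'I_N.+1) : R :=
  if unlift ord0 r is Some k then T i j k else ((i == ord0) && (j == ord0))%:R.
apply: (rank_le_dual (B := B)) => [k|u uB].
  by exists (lift ord0 k) => i j; rewrite /B liftK.
have key c : (K <= c < l)%N ->
    [/\ u ord0 ord0 = 0, forall k, (k < K)%N -> mu u k = 0 & mu u c = 0].
  (* Expanding [corner] as 1 minus a combination of the [T 0 0 k] turns [mu u] into [nu], with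
     constant term [u ord0 ord0]. *)
  move=> hc; pose nu k := mu u k - u ord0 ord0 * T 0 0 k.
  have [|u0 c1 c0] := @quad_curve_nondegenerate R _ _ al be _ _ (u ord0 ord0)
      (\det (inner_mx M N T) * cramer1 M N T c nu)
      (fun q => \det (inner_mx M N T) * cramer (M := M) (N := N) T nu q) (dH c hc).
  - move=> t z zE; have := pairing_curve u hc zE.
    rewrite (uB _ _ (fun r => if unlift ord0 r is Some k then curve_coef M0 T c t z k
      else corner c t z)); last first.
      move=> i j; rewrite (curve_rank_one_corner hc zE) big_ord_recl /B unlift_none.
      by congr (_ + _); apply: eq_bigr => k _; rewrite liftK.
    have := curve_coef_sum M0 T t z nu hc; rewrite /nu.
    under eq_bigr do rewrite mulrBr mulrCA; rewrite sumrB -mulr_sumr => E1 E2.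
    under eq_bigr do rewrite -mulrA.
    rewrite -mulr_sumr -addrA -mulrA -mulrDr -E1 [RHS]E2 /corner; ring.
  - have [||m1 m2] := @cramer_eq0 R M N T c nu dT.
    + by move/eqP: c1; rewrite mulf_eq0 (negbTE dT) => /eqP.
    + by move=> q; move/eqP: (c0 q); rewrite mulf_eq0 (negbTE dT) => /eqP.
    + by split=> // [k /m1|]; [|move: m2]; rewrite /nu u0 mul0r subr0.
move=> r; rewrite /B; case: unliftP => [k|] _.
  have [kK|Kk] := ltnP k K.
    by have [|_ + _] := key K; [rewrite leqnn|apply].
  by have [|] := key k; [rewrite Kk ltn_ord|].
have -> : (fun (i : 'I_M.+1) (j : 'I_N.+1) => ((i == ord0) && (j == ord0))%:R) =
    (fun i j => 1 * ((i == ord0) && (j == ord0))%:R) :> ('I_M.+1 -> 'I_N.+1 -> R).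
  by apply/funext => i; apply/funext => j; rewrite mul1r.
by rewrite pairing_corner; have [|-> _ _] := key K; [rewrite leqnn|rewrite mulr0].
Qed.

(** The equation in the hypothesis says [corner = 0]: at such points the rank-one matrix lies in the
    span of the slices alone, so [l] matrices suffice. *)
Lemma rank_le_zeros :
  (forall c, (K <= c < l)%N -> forall l1 l',
    (forall t z, on_curve c t z ->
      -1 + (\det (inner_mx M N T) * cramer1 M N T c (T 0 0)) * t +
        \sum_q (\det (inner_mx M N T) * cramer T (T 0 0) q) * (z (al q) * z (be q)) = 0 ->
      l1 * t + \sum_q l' q * (z (al q) * z (be q)) = 0) ->
    l1 = 0 /\ forall q, l' q = 0) ->
  rank_le TT l.
Proof.
move=> H; apply: (rank_le_dual (B := fun k i j => T i j k)) => [k|u uB]; first by exists k.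
have key c : (K <= c < l)%N -> (forall k, (k < K)%N -> mu u k = 0) /\ mu u c = 0.
  move=> hc; have [t z zE g0|c1 c0] := H c hc (\det (inner_mx M N T) * cramer1 M N T c (mu u))
      (fun q => \det (inner_mx M N T) * cramer T (mu u) q).
    have corner0 : corner c t z = 0.
      rewrite /corner (curve_coef_sum M0 T t z (T 0 0) hc); move: g0.
      under eq_bigr do rewrite -mulrA; rewrite -mulr_sumr => g0.
      by apply: oppr_inj; rewrite oppr0 -[RHS]g0 /al /be; ring.
    have := pairing_curve u hc zE; rewrite corner0 mul0r add0r.
    rewrite (uB _ _ (fun k => curve_coef M0 T c t z k)); last first.
      by move=> i j; rewrite (curve_rank_one_corner hc zE) corner0 mul0r add0r.
    rewrite (curve_coef_sum M0 T t z (mu u) hc) => E; rewrite [RHS]E.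
    under eq_bigr do rewrite -mulrA.
    by rewrite -mulr_sumr -mulrA -mulrDr.
  apply: (@cramer_eq0 R M N T c (mu u) dT).
    by move/eqP: c1; rewrite mulf_eq0 (negbTE dT) => /eqP.
  by move=> q; move/eqP: (c0 q); rewrite mulf_eq0 (negbTE dT) => /eqP.
move=> k; have [kK|Kk] := ltnP k K.
  by have [|+ _] := key K; [rewrite leqnn|apply].
by have [|] := key k; [rewrite Kk ltn_ord|].
Qed.

End rank_bounds.

(** * The base tensor *)

Lemma polyfun_jet (R : realType) (p K : nat) (al be : 'I_K -> 'I_p)
    (C : (nat -> R) -> 'I_p -> 'I_K -> R) (w : (nat -> R) -> 'I_p -> R) :
  (forall a q, polyfun (fun x => C x a q)) -> (forall a, polyfun (fun x => w x a)) ->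
  polyfun (fun x => \det (jet_mx al be (C x) (w x))).
Proof.
move=> pC pw.
have pX (F G : (nat -> R) -> {poly R}) : (forall j, polyfun (fun x => (F x)`_j)) ->
    (forall j, polyfun (fun x => (G x)`_j)) -> forall j, polyfun (fun x => (F x * G x)`_j).
  move=> pF pG j.
  apply: (@polyfun_ext _ (fun x => \sum_(i < j.+1) (F x)`_i * (G x)`_(j - i))).
    by move=> x; rewrite coefM.
  by apply: polyfun_sum => i _; apply: polyfunM.
have pc (F : (nat -> R) -> R) : polyfun F -> forall j, polyfun (fun x => (F x)%:P`_j).
  move=> pF [|j]; first by apply: polyfun_ext pF => x; rewrite coefC.
  by apply: polyfun_ext (polyfun_cst 0) => x; rewrite coefC.
have pit i a j : polyfun (fun x => (quad_iter al be (C x) (w x) i a)`_j).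
  elim: i a j => [|i IH] a j.
    by apply: polyfun_ext (polyfun_cst 0) => x; rewrite /quad_iter/= coef0.
  apply: (@polyfun_ext _ (fun x => ('X * (w x a)%:P)`_j + \sum_q ((C x a q)%:P *
      (quad_iter al be (C x) (w x) i (al q) * quad_iter al be (C x) (w x) i (be q)))`_j)).
    by move=> x; rewrite [in RHS]/quad_iter/= /quad_map coefD coef_sum.
  apply: polyfunD.
    by apply: pX => j'; [exact: polyfun_cst|exact: pc].
  apply: polyfun_sum => q _; apply: (pX); first exact: pc.
  by apply: (pX).
apply: polyfun_det => q e.
apply: (@polyfun_ext _ (fun x => (quad_iter al be (C x) (w x) K (al q) *
  quad_iter al be (C x) (w x) K (be q))`_e.+2)) => [x|]; first by rewrite mxE.
exact: pX.
Qed.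

Lemma polyfun_continuous_fam (R : realType) (I : finType) (F : I -> (nat -> R) -> R)
    (a : nat -> R) (e : R) : (forall i, polyfun (F i)) -> 0 < e ->
  exists2 d, 0 < d & forall x, (forall i, `|x i - a i| <= d) ->
    forall i, `|F i x - F i a| <= e.
Proof.
move=> pF e0; have /choice[d dP] i : exists d, 0 < d /\
    forall x, (forall k, `|x k - a k| <= d) -> `|F i x - F i a| <= e.
  by have [d d0 dP] := polyfun_continuous a (pF i) e0; exists d.
exists (\big[Order.min/1]_i d i) => [|x xa i].
  by apply: lt_bigmin => // i _; have [] := dP i.
by have [_] := dP i; apply => k; apply: le_trans (xa k) (bigmin_le _ _ _).
Qed.

Section base_tensor.
Variables (R : realType) (M N : nat).
Hypotheses (M0 : (0 < M)%N) (N0 : (0 < N)%N).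
Local Notation K := (M * N)%N.

(** Exponent of [t] at entry [(i, j)] of the monomial rank-one matrix; an inner entry has the sum of
    the exponents of its first-column and first-row entries. *)
Definition expo (i j : nat) := (i + (if j is j'.+1 then (M * j').+1 else 0))%N.

(* Whatever [g], the curve attached to this tensor is the monomial one, with
   coordinates [t ^ expo i j], for each of the slices of index at least [K]. *)
Definition base_tensor (g : nat -> R) (i j k : nat) : R :=
  if (i == 0%N) && (j == 0%N) then g k
  else (if (k < K)%N then expo i j == k.+2 else expo i j == 1%N)%:R.

Definition curve_exp (a : 'I_(M + N)) := expo (row_of M a) (col_of M a).

Lemma expo_inner (q : 'I_K) : expo (q %% M).+1 (q %/ M).+1 = q.+2.
Proof. by rewrite /expo {3}(divn_eq q M); lia. Qed.

Lemma curve_exp_bound a : (0 < curve_exp a <= K.+1)%N.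
Proof.
rewrite /curve_exp /row_of /col_of /expo; have [aM|Ma] := ltnP a M.
  by have MK := leq_pmulr M N0; rewrite addn0/=; lia.
have aN : (a - M < N)%N by rewrite ltn_subLR.
have MK : (M * (a - M) + M <= K)%N by rewrite addnC -mulnS leq_mul2l aN orbT.
by rewrite add0n/=; lia.
Qed.

Lemma curve_exp_sum (q : 'I_K) :
  (curve_exp (left_index M0 q) + curve_exp (right_index M0 q))%N = q.+2.
Proof.
rewrite /curve_exp /row_of /col_of/= ltn_mod M0 ltnNge leq_addr/= addKn /expo/=.
by rewrite {3}(divn_eq q M); lia.
Qed.

Variables (l : nat) (g : nat -> R) (T : nat -> nat -> nat -> R).
Hypothesis (Kl : (K < l)%N).
Hypothesis T_base : forall i j k, (i <= M)%N -> (j <= N)%N -> (k < l)%N ->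
  T i j k = base_tensor g i j k.

Let T_inner (q : 'I_K) k : (k < l)%N ->
  T (q %% M).+1 (q %/ M).+1 k = (if (k < K)%N then val q == k else false)%:R.
Proof.
move=> kl; have qM : ((q %% M).+1 <= M)%N by rewrite ltn_mod.
have qN : ((q %/ M).+1 <= N)%N by rewrite ltn_divLR// [X in (_ < X)%N]mulnC.
rewrite T_base//.
by rewrite /base_tensor/= expo_inner !eqSS.
Qed.

Lemma inner_mx_base : inner_mx M N T = 1%:M.
Proof.
apply/matrixP => q k; rewrite !mxE T_inner ?ltn_ord//; last exact: ltn_trans Kl.
Qed.

Lemma cramer_base mu (q : 'I_K) : cramer T mu q = mu q.
Proof.
rewrite /cramer inner_mx_base.
have -> : \adj (1%:M : 'M[R]_K) = 1%:M.
  by rewrite -[LHS]mul1mx mul_mx_adj det1.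
rewrite (bigD1 q)//= big1 => [|k kq]; rewrite mxE ?eqxx ?mulr1 ?addr0//.
by rewrite (negbTE kq) mulr0.
Qed.

Lemma cramer1_base mu c : (K <= c < l)%N -> cramer1 M N T c mu = mu c.
Proof.
move=> /andP[Kc cl]; rewrite /cramer1 inner_mx_base det1 mul1r big1 ?subr0// => q _.
by rewrite mxE T_inner// ltnNge Kc mulr0.
Qed.

Let row_col a : (row_of M a <= M)%N /\ (a < M + N -> col_of M a <= N)%N /\
  (row_of M a == 0%N) && (col_of M a == 0%N) = false.
Proof. by rewrite /row_of /col_of; case: ltnP => aM; split=> //; split=> //; lia. Qed.

Lemma curve_C_base (a : 'I_(M + N)) (q : 'I_K) :
  curve_C T a q = (curve_exp a == q.+2)%:R.
Proof.
have [ra [ca rc]] := row_col a; have ql := ltn_trans (ltn_ord q) Kl.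
by rewrite /curve_C cramer_base T_base ?ca// /base_tensor rc ltn_ord.
Qed.

Lemma curve_w_base c (a : 'I_(M + N)) : (K <= c < l)%N ->
  curve_w T c a = (curve_exp a == 1%N)%:R.
Proof.
move=> hc; have [ra [ca rc]] := row_col a; have /andP[Kc cl] := hc.
by rewrite /curve_w cramer1_base// T_base ?ca// /base_tensor rc ltnNge Kc.
Qed.

End base_tensor.

(** * Tensors as sequences of coordinates *)

Section coordinates.
Variables (R : realType) (m n l : nat).

Definition coord_tensor (x : nat -> R) (i j k : nat) : R := x ((i * n + j) * l + k)%N.

(** Inverse of the flattening in [tensor_of], extended by [0], the value at which [gauss_prob] fixes
    the coordinates beyond the format. *)
Definition tensor_coord (T : nat -> nat -> nat -> R) (h : nat) : R :=
  if (h < m * n * l)%N then T (h %/ l %/ n)%N (h %/ l %% n)%N (h %% l)%N else 0.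

Lemma tensor_coordK T i j k : (i < m)%N -> (j < n)%N -> (k < l)%N ->
  coord_tensor (tensor_coord T) i j k = T i j k.
Proof.
move=> im jn kl; have l0 := leq_ltn_trans (leq0n k) kl.
have n0 := leq_ltn_trans (leq0n j) jn.
rewrite /coord_tensor /tensor_coord ifT.
  rewrite divnMDl// (divn_small kl) addn0 divnMDl// (divn_small jn) addn0.
  by rewrite !modnMDl !modn_small.
have h1 : (i * n + j < m * n)%N by nia.
by nia.
Qed.

Lemma tensor_coord_ge T h : (m * n * l <= h)%N -> tensor_coord T h = 0.
Proof. by rewrite /tensor_coord leqNgt => /negbTE ->. Qed.

Lemma polyfun_coord_tensor i j k : polyfun (fun x => coord_tensor x i j k).
Proof. exact: polyfun_coord. Qed.

End coordinates.

Section polyfun_curve.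
Variables (R : realType) (M N n l : nat).
Local Notation K := (M * N)%N.
Local Notation TX x := (coord_tensor n l (x : nat -> R)).

Lemma polyfun_inner_mx i j : polyfun (fun x => inner_mx M N (TX x) i j).
Proof.
apply: polyfun_ext (polyfun_coord_tensor R n l (i %% M).+1 (i %/ M).+1 j) => x.
by rewrite mxE.
Qed.

Lemma polyfun_det_inner : polyfun (fun x => \det (inner_mx M N (TX x))).
Proof. by apply: polyfun_det => i j; exact: polyfun_inner_mx. Qed.

Lemma polyfun_cramer i j (q : 'I_K) :
  polyfun (fun x => cramer (TX x) (TX x i j) q).
Proof.
apply: polyfun_sum => k _; apply: polyfunM; first exact: polyfun_coord_tensor.
by apply: polyfun_adj => i' j'; exact: polyfun_inner_mx.
Qed.

Lemma polyfun_cramer1 i j c : polyfun (fun x => cramer1 M N (TX x) c (TX x i j)).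
Proof.
apply: polyfunD.
  by apply: polyfunM; [exact: polyfun_det_inner|exact: polyfun_coord_tensor].
apply: polyfunN; apply: polyfun_sum => q _; apply: polyfunM; first exact: polyfun_cramer.
apply: polyfun_ext (polyfun_coord_tensor R n l (q %% M).+1 (q %/ M).+1 c) => x.
by rewrite mxE.
Qed.

End polyfun_curve.

(** * Typical ranks *)

Section typical_ranks.
Variables (R : realType) (M N l : nat).
Hypotheses (M0 : (0 < M)%N) (N0 : (0 < N)%N).
Local Notation K := (M * N)%N.
Hypotheses (Kl : (K < l)%N) (lmn : (l <= M.+1 * N.+1)%N).
Local Notation TX x := (coord_tensor N.+1 l (x : nat -> R)).
Local Notation rank_is r := [set x : nat -> R |
  @tensor_rank_is R M.+1 N.+1 l (@tensor_of R M.+1 N.+1 l x) r].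

Let al := @left_index M N M0.
Let be := @right_index M N M0.

(** Rows are the first [l] matrix positions in row-major order; they exist because
    [l <= M.+1 * N.+1]. *)
Let minor (x : nat -> R) := \det (\matrix_(k', k < l) TX x (k' %/ N.+1)%N (k' %% N.+1)%N k).

Let polyfun_minor : polyfun minor.
Proof.
apply: polyfun_det => i j.
by apply: polyfun_ext (polyfun_coord_tensor R N.+1 l (i %/ N.+1) (i %% N.+1) j) => x; rewrite mxE.
Qed.

Let minor_row (k : 'I_l) : (k %/ N.+1 < M.+1)%N.
Proof. by rewrite ltn_divLR// (leq_trans (ltn_ord k)). Qed.

Let minor_rank x r : minor x != 0 ->
  rank_le (@tensor_of R M.+1 N.+1 l x) r -> (l <= r)%N.
Proof.
move=> mx; apply: (@rank_le_minor _ _ _ _ _ _ (fun k => Ordinal (minor_row k))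
  (fun k => Ordinal (ltn_pmod k (ltn0Sn N)))).
exact: mx.
Qed.

Let minor_nonzero : exists2 y, (forall i, (M.+1 * N.+1 * l <= i)%N -> y i = 0) & minor y != 0.
Proof.
exists (tensor_coord M.+1 N.+1 l (fun i j k => (i * N.+1 + j == k)%N%:R)).
  by move=> i; exact: tensor_coord_ge.
rewrite /minor (_ : \matrix_(_, _) _ = 1%:M) ?det1 ?oner_neq0//.
apply/matrixP => i j; rewrite !mxE tensor_coordK ?ltn_pmod ?minor_row//.
by rewrite -divn_eq.
Qed.

Lemma rank_lt_null r : (r < l)%N -> gauss_prob (M.+1 * N.+1 * l) (rank_is r) = 0%E.
Proof.
move=> rl; apply: (gauss_iint_zeros polyfun_minor) => // z [zr _].
by apply/eqP; apply: contraTT rl => mz; rewrite -leqNgt; exact: minor_rank zr.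
Qed.

(** One polynomial whose nonvanishing yields all the hypotheses of [rank_le_generic], for every [c]
    at once. *)
Let generic (x : nat -> R) := \det (inner_mx M N (TX x)) *
  \prod_(c < l | (K <= c)%N)
     \det (jet_mx al be (curve_C (N := N) (TX x)) (curve_w (N := N) (TX x) c)).

Let polyfun_generic : polyfun generic.
Proof.
apply: polyfunM; first exact: polyfun_det_inner.
apply: polyfun_prod => c _; apply: polyfun_jet => [a q|a].
  exact: polyfun_cramer.
exact: polyfun_cramer1.
Qed.

Let base (g : nat -> R) := tensor_coord M.+1 N.+1 l (base_tensor M N g).

Let baseE g i j k : (i <= M)%N -> (j <= N)%N -> (k < l)%N ->
  TX (base g) i j k = base_tensor M N g i j k.
Proof. by move=> iM jN kl; rewrite tensor_coordK. Qed.

Let curve_C_base' g a q :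
  curve_C (TX (base g)) a q = (@curve_exp M N a == q.+2)%:R.
Proof. by rewrite (curve_C_base M0 N0 Kl (@baseE g)). Qed.

Let curve_w_base' g c a : (K <= c < l)%N ->
  curve_w (TX (base g)) c a = (@curve_exp M N a == 1%N)%:R.
Proof. exact: (curve_w_base M0 N0 Kl (@baseE g)). Qed.

Lemma rank_gt_null r : (l.+1 < r)%N ->
  gauss_prob (M.+1 * N.+1 * l) (rank_is r) = 0%E.
Proof.
move=> rl; apply: (gauss_iint_zeros polyfun_generic).
  move=> z [_ zr]; apply/eqP; apply: contraTT rl => /[!mulf_eq0] /norP[dz /prodf_neq0 jz].
  rewrite -leqNgt; apply: zr.
  by apply: (@rank_le_generic R M N l M0 Kl _ dz) => c /andP[Kc cl]; exact: (jz (Ordinal cl)).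
(* At the base tensor every attached curve is monomial, so all the determinants equal 1. *)
exists (base (fun=> 0)); first by move=> i; exact: tensor_coord_ge.
rewrite /generic (inner_mx_base M0 N0 Kl (@baseE (fun=> 0))) det1 mul1r.
apply/prodf_neq0 => c Kc.
rewrite (_ : curve_C _ = fun a q => (@curve_exp M N a == q.+2)%:R); last first.
  by apply/funext => a; apply/funext => q; rewrite curve_C_base'.
rewrite (_ : curve_w _ _ = fun a => (@curve_exp M N a == 1%N)%:R); last first.
  by apply/funext => a; rewrite curve_w_base'// Kc ltn_ord.
rewrite jet_mx_monomial ?det1 ?oner_neq0//.
- exact: curve_exp_bound.
- exact: curve_exp_sum.
Qed.

(** Every tensor in a box around the base tensor has rank at most [l], by persistence of zeros;
    outside the zero set of the minor it also has rank at least [l]. *)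
Lemma rank_l_typical : (0 < gauss_prob (M.+1 * N.+1 * l) (rank_is l))%E.
Proof.
have [g1 [g [d [d0 gP]]]] := curve_zeros_persist R
  (al := al) (be := be) (ex := @curve_exp M N) (curve_exp_bound M0 N0) (curve_exp_sum M0 N0).
(* Corner entries that make the hyperplane equation of each [c] the one with coefficients [g1] and
   [g]: the entry is [g1] in every slice from [K] on. *)
pose gg (k : nat) := if insub k is Some q then g q else g1.
pose x0 := base gg.
pose e := Num.min d 2^-1.
have e0 : 0 < e by rewrite lt_min d0 invr_gt0 ltr0n.
have ed : e <= d by rewrite ge_min lexx.
have e2 : e <= 2^-1 by rewrite ge_min lexx orbT.
have [d1 d10 d1P] := @polyfun_continuous_fam R _
  (fun (i : 'I_(M + N) * 'I_K) x => curve_C (TX x) i.1 i.2) x0 e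
  (fun i => polyfun_cramer R N.+1 l _ _ _) e0.
have [d2 d20 d2P] := @polyfun_continuous_fam R _
  (fun (i : 'I_(M + N) * 'I_l) x => curve_w (N := N) (TX x) i.2 i.1) x0 e
  (fun i => polyfun_cramer1 R M N N.+1 l _ _ _) e0.
have [d3 d30 d3P] := @polyfun_continuous R _ x0 e (polyfun_det_inner R M N N.+1 l) e0.
have [d4 d40 d4P] := @polyfun_continuous_fam R _
  (fun (c : 'I_l) x => \det (inner_mx M N (TX x)) * cramer1 M N (TX x) c (TX x 0 0)%N) x0 e
  (fun i => polyfunM (polyfun_det_inner R M N N.+1 l) (polyfun_cramer1 R M N N.+1 l _ _ _)) e0.
have [d5 d50 d5P] := @polyfun_continuous_fam R _
  (fun (q : 'I_K) x => \det (inner_mx M N (TX x)) * cramer (TX x) (TX x 0 0)%N q) x0 e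
  (fun i => polyfunM (polyfun_det_inner R M N N.+1 l) (polyfun_cramer R N.+1 l _ _ _)) e0.
pose b := Num.min d1 (Num.min d2 (Num.min d3 (Num.min d4 d5))).
have b0 : 0 < b by rewrite !lt_min d10 d20 d30 d40.
(* A single point with nonzero minor, possibly outside the box, is enough for the minor to be
   nonzero off a negligible set. *)
have [y yN my] := minor_nonzero.
apply: (@gauss_iint_box R _ _ x0 b _ _ polyfun_minor b0); last first.
- by exists y => // i /yN ->.
- by move=> i /(tensor_coord_ge (base_tensor M N gg)) h; rewrite /x0 /base h subrr normr0 ltW.
move=> z zx mz; split; last by move=> r'; exact: minor_rank.
have [bd1 bd2 bd3 bd4 bd5] : [/\ b <= d1, b <= d2, b <= d3, b <= d4 & b <= d5].
  by split; rewrite /b !ge_min lexx ?orbT.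
have near (u : R) : b <= u -> forall i, `|z i - x0 i| <= u.
  by move=> bu i; apply: le_trans (zx i) bu.
have {}d1P := d1P z (near _ bd1).
have {}d2P := d2P z (near _ bd2).
have {}d3P := d3P z (near _ bd3).
have {}d4P := d4P z (near _ bd4).
have {}d5P := d5P z (near _ bd5).
have i1 := inner_mx_base M0 N0 Kl (@baseE gg).
have dz : \det (inner_mx M N (TX z)) != 0.
  apply: contraTneq d3P => ->; rewrite i1 det1 sub0r normrN normr1 -ltNge.
  by apply: le_lt_trans e2 _; lra.
apply: (@rank_le_zeros _ _ _ _ M0 Kl _ dz) => c hc; have /andP[Kc cl] := hc.
apply: gP => [a q|a||q].
- by have := d1P (a, q); rewrite /= curve_C_base' => /le_trans; apply.
- by have := d2P (a, Ordinal cl); rewrite /= curve_w_base'// => /le_trans; apply.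
- have := d4P (Ordinal cl); rewrite /= i1 det1 mul1r (cramer1_base M0 N0 Kl (@baseE gg))//.
  rewrite baseE// /base_tensor/= /gg insubF; last by rewrite ltnNge Kc.
  by move=> /le_trans; apply.
- have := d5P q; rewrite /= i1 det1 mul1r (cramer_base M0 N0 Kl (@baseE gg)).
  rewrite baseE//; last exact: ltn_trans (ltn_ord q) Kl.
  by rewrite /base_tensor/= /gg valK => /le_trans; apply.
Qed.

End typical_ranks.

Theorem theorem1p1 (R : realType) (m n l : nat) :
  (2 <= m)%N -> (m <= n)%N -> (n <= l)%N ->
  ((m - 1) * (n - 1) + 1 <= l)%N -> (l <= m * n)%N ->
  (forall r : nat, typical_rank R m n l r -> r = l \/ r = l.+1) /\
  typical_rank R m n l l.
Proof.
case: m n => [|M] [|N]// M2 MN _ Kl lmn.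
have M0 : (0 < M)%N by [].
have N0 : (0 < N)%N by exact: leq_trans M0 MN.
rewrite !subn1 addn1 /= in Kl.
split=> [r [_ r0]|]; last first.
  by split; [exact: leq_ltn_trans Kl|exact: rank_l_typical].
have [rl|lr] := ltnP r l; first by rewrite rank_lt_null ?ltxx in r0.
have [lr'|rl] := ltnP l.+1 r; first by rewrite rank_gt_null ?ltxx in r0.
by move: lr rl; rewrite leq_eqVlt => /orP[/eqP|]; [left|right; apply/eqP; rewrite eqn_leq rl].
Qed.
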